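(* Let $G$ be a countable discrete abelian group and let $\varphi,\psi:G\to G$ be homomorphisms such that $\varphi(G)$, $\psi(G)$ and $(\varphi-\psi)(G)$ all have finite index in $G$. For any $E\subseteq G$ with $d^*(E)>0$ and any $\varepsilon>0$, the set $$\left\{ g\in G : d^*\left(E\cap(E-\varphi(g))\cap(E-\psi(g))\right) > d^*(E)^3-\varepsilon\right\}$$ is syndetic.
   Context: A Følner sequence in $G$ is a sequence of finite sets $F_N\subseteq G$ with $|(F_N+g)\triangle F_N|/|F_N|\to0$ for every $g\in G$. The upper Banach density of $E\subseteq G$ is $d^*(E)=\sup\{\limsup_{N\to\infty}|E\cap F_N|/|F_N| : (F_N)\text{ a Følner sequence in }G\}$. For $E\subseteq G$, $h\in G$, $E-h=\{e-h:e\in E\}$. A subset $S\subseteq G$ is syndetic if finitely many translates of $S$ cover $G$. *)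

(* Defs.v *)
From HB Require Import structures.
From mathcomp Require Import all_boot all_order all_algebra.
From mathcomp Require Import finmap.
From mathcomp Require Import all_classical all_reals all_analysis.
Set Implicit Arguments. Unset Strict Implicit. Unset Printing Implicit Defensive.
Import Order.TTheory GRing.Theory Num.Theory.
Import numFieldNormedType.Exports.
Local Open Scope classical_set_scope.
Local Open Scope ring_scope.
Local Open Scope fset_scope.

Section Defs.
Variables (R : realType) (G : countZmodType).

Definition ftranslate (F : {fset G}) (g : G) : {fset G} := [fset (x + g)%R | x in F].

Definition fsymdiff (A B : {fset G}) : {fset G} := (A `\` B) `|` (B `\` A).

Definition Folner (F : nat -> {fset G}) : Prop :=
  (forall N, F N != fset0) /\
  forall g : G,
    (fun N => (#|` fsymdiff (ftranslate (F N) g) (F N)|%:R / #|` F N|%:R : R))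
      @ \oo --> (0 : R).

Definition fdens (E : set G) (F : {fset G}) : R :=
  #|` [fset x in F | x \in E]|%:R / #|` F|%:R.

Definition upper_banach_density (E : set G) : R :=
  sup [set l : R | exists F : nat -> {fset G},
         Folner F /\ l = limn_sup (fun N => fdens E (F N))].

Definition set_shift (E : set G) (h : G) : set G := [set e - h | e in E].

Definition syndetic (S : set G) : Prop :=
  exists K : {fset G}, forall g : G, exists2 k, k \in K & S (g - k).

Definition finite_index (H : set G) : Prop :=
  exists K : {fset G}, forall g : G, exists2 k, k \in K & H (g - k).
End Defs.

(* Main.v *)
Require Import Defs.
From HB Require Import structures.
From mathcomp Require Import all_boot all_order all_algebra.
From mathcomp Require Import finmap.
From mathcomp Require Import all_classical all_reals all_analysis.
From mathcomp Require Import ring lra.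
Set Implicit Arguments. Unset Strict Implicit. Unset Printing Implicit Defensive.
Import Order.TTheory GRing.Theory Num.Theory.
Import numFieldNormedType.Exports.
Local Open Scope classical_set_scope.
Local Open Scope ring_scope.

(** Finitely additive means replace measures. The upper Banach density of [E] is the largest
    value at [1_E] of a translation-invariant mean on the bounded functions on [G], and an
    extreme point [m] of the set of maximizing means is ergodic: every invariant mean [n]
    satisfies [n_g m(b * T_g f) = m b * m f]. Relative to [m], a function orthogonal to the
    Bohr almost periodic functions is weakly mixing, so by van der Corput's inequality (this is
    where the three finite indices enter) it is negligible in the averages
    [n_g W(g) m(f * T_{phi g} f * T_{psi g} f)] with an almost periodic weight [W >= 0].
    Replacing [f = 1_E] by an almost periodic approximation [a], and letting [W] live on those
    [g] for which [phi g] and [psi g] are almost periods of [a], such an average is at least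
    about [n W * m (a ^ 3) >= n W * (m a) ^ 3], and [m a] is about the density of [E]. If the
    set of good [g] were not syndetic, some invariant mean [n] would vanish on it, which
    contradicts this lower bound. *)

(** * Bounded functions and states *)

Section Bounded.
Variable R : realType.

(** If the good [g] are not syndetic, all that is known is some invariant mean [n] killing them;
    hence ergodicity of [m] is required against every [n]. Finitely additive means have neither
    Fubini's theorem nor complete function spaces, and three devices make up for this. Projections
    onto almost periodic functions become near-minimizers of the distance, with errors carried
    along. Averages over an auxiliary parameter become finite sums whose terms are picked one at a
    time, each correlating by at most a constant with the sum so far. Iterated means are exchanged
    only where the dependence on one variable is, up to a small error, finite-valued. The weight [W]
    is there because the unweighted average of an almost periodic [a] need not reach [m (a ^ 3)];
    for the contradiction it is enough that [n W > 0]. *)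

Definition bdd (T : Type) (f : T -> R) : Prop := exists M, forall x, `|f x| <= M.

Variable T : Type.
Implicit Types f g : T -> R.

Lemma bdd_by f M : (forall x, `|f x| <= M) -> bdd f.
Proof. by exists M. Qed.

Lemma bdd_cst c : bdd (fun _ : T => c).
Proof. by exists `|c|. Qed.

Lemma bddD f g : bdd f -> bdd g -> bdd (fun x => f x + g x).
Proof.
by move=> [M hM] [N hN]; exists (M + N) => x; rewrite (le_trans (ler_normD _ _))// lerD.
Qed.

Lemma bddN f : bdd f -> bdd (fun x => - f x).
Proof. by move=> [M hM]; exists M => x; rewrite normrN. Qed.

Lemma bddM f g : bdd f -> bdd g -> bdd (fun x => f x * g x).
Proof. by move=> [M hM] [N hN]; exists (M * N) => x; rewrite normrM ler_pM. Qed.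

Lemma bddX f n : bdd f -> bdd (fun x => f x ^+ n).
Proof. by move=> [M hM]; exists (M ^+ n) => x; rewrite normrX lerXn2r ?nnegrE ?(le_trans _ (hM x)). Qed.

Lemma bdd_norm f : bdd f -> bdd (fun x => `|f x|).
Proof. by move=> [M hM]; exists M => x; rewrite normr_id. Qed.

Lemma bdd_max f g : bdd f -> bdd g -> bdd (fun x => Num.max (f x) (g x)).
Proof.
move=> [M hM] [N hN]; exists (M + N) => x; have := hM x; have := hN x.
have := normr_ge0 (f x); have := normr_ge0 (g x).
by rewrite /Num.max; case: ifP => _; lra.
Qed.

Lemma bdd_min f g : bdd f -> bdd g -> bdd (fun x => Num.min (f x) (g x)).
Proof.
move=> [M hM] [N hN]; exists (M + N) => x; have := hM x; have := hN x.
have := normr_ge0 (f x); have := normr_ge0 (g x).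
by rewrite /Num.min; case: ifP => _; lra.
Qed.

Lemma bdd_comp (T' : Type) (f : T' -> R) (k : T -> T') : bdd f -> bdd (fun x => f (k x)).
Proof. by move=> [M hM]; exists M. Qed.

Lemma bdd_comp2 (T1 T2 : Type) (f : T1 -> T2 -> R) (k : T -> T1) (l : T -> T2) :
  bdd (fun p => f p.1 p.2) -> bdd (fun x => f (k x) (l x)).
Proof. by move=> [M hM]; exists M => x; exact: (hM (k x, l x)). Qed.

Lemma bdd_sum (I : Type) (s : seq I) (F : I -> T -> R) :
  (forall i, bdd (F i)) -> bdd (fun x => \sum_(i <- s) F i x).
Proof.
move=> h; elim: s => [|i s [N IH]].
  by exists 0 => x; rewrite big_nil normr0.
by have [M hM] := h i; exists (M + N) => x; rewrite big_cons (le_trans (ler_normD _ _))// lerD.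
Qed.

Lemma bdd_b2r (b : T -> bool) : bdd (fun x => (b x)%:R).
Proof. by exists 1 => x; case: (b x); rewrite ?normr1 ?normr0. Qed.

Lemma bdd_gt0 f : bdd f -> exists2 M, 0 < M & forall x, `|f x| <= M.
Proof.
move=> [M hM]; exists (`|M| + 1) => [|x]; first by rewrite ltr_wpDl.
by rewrite (le_trans (hM x))// (le_trans (ler_norm _))// lerDl.
Qed.

End Bounded.

Section State.
Variables (R : realType).

(** A finitely additive probability measure seen as a functional. It is total, with laws stated for
    bounded functions; elsewhere its value is arbitrary. *)
Record state (T : Type) := State {
  st :> (T -> R) -> R;
  stD : forall f g, bdd f -> bdd g -> st (fun x => f x + g x) = st f + st g;
  stZ : forall c f, bdd f -> st (fun x => c * f x) = c * st f;
  st_ge0 : forall f, bdd f -> (forall x, 0 <= f x) -> 0 <= st f;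
  st1 : st (fun _ => 1) = 1 }.

(** The bound is uniform in both variables, so that iterated states stay where the laws hold. *)
Lemma bdd_st (T T' : Type) (n : state T') (F : T -> T' -> R) :
  bdd (fun p => F p.1 p.2) -> bdd (fun x => n (F x)).
Proof.
move=> [M hM].
have h x : bdd (F x) by exists M => y; exact: (hM (x, y)).
have hc c : n (fun=> c) = c.
  by rewrite -[RHS]mulr1 -(st1 n) -stZ ?mulr1//; exact: bdd_cst.
have le x : n (F x) <= M.
  rewrite -subr_ge0 -(hc M) -mulN1r -stZ// -stD; [|exact: bdd_cst|by exact: bddM (bdd_cst _ _) (h x)].
  apply: st_ge0 => [|y].
    by apply: bddD; [exact: bdd_cst|exact: bddM (bdd_cst _ _) (h x)].
  by have := hM (x, y); rewrite mulN1r ler_norml subr_ge0 => /andP[].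
have ge x : - M <= n (F x).
  rewrite -subr_ge0 opprK -(hc M) -stD; [|by []|exact: bdd_cst].
  apply: st_ge0 => [|y]; first by apply: bddD => //; exact: bdd_cst.
  by have := hM (x, y); rewrite ler_norml -lerBlDr sub0r => /andP[].
by exists M => x; rewrite ler_norml le ge.
Qed.

End State.

Ltac bdd_atom :=
  first [ assumption
        | match goal with H : forall _, bdd _ |- _ => exact: (H _) end ].

Ltac bdd_tac :=
  cbv beta; simpl fst; simpl snd;
  first [ bdd_atom |
  lazymatch goal with
  | |- bdd (fun x => @GRing.add _ (@?a x) (@?b x)) => apply: (@bddD _ _ a b); bdd_tac
  | |- bdd (fun x => @GRing.opp _ (@?a x)) => apply: (@bddN _ _ a); bdd_tac
  | |- bdd (fun x => @GRing.mul _ (@?a x) (@?b x)) => apply: (@bddM _ _ a b); bdd_tac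
  | |- bdd (fun x => @GRing.exp _ (@?a x) ?n) => apply: (@bddX _ _ a n); bdd_tac
  | |- bdd (fun x => @Num.norm _ _ (@?a x)) => apply: (@bdd_norm _ _ a); bdd_tac
  | |- bdd (fun x => Num.max (@?a x) (@?b x)) => apply: (@bdd_max _ _ a b); bdd_tac
  | |- bdd (fun x => Num.min (@?a x) (@?b x)) => apply: (@bdd_min _ _ a b); bdd_tac
  | |- bdd (fun x => st ?n (@?F x)) => apply: (@bdd_st _ _ _ n F); bdd_tac
  | |- bdd (fun x => (nat_of_bool (@?b x))%:R) => apply: (@bdd_b2r _ _ b)
  | |- bdd (fun _ => ?c) => apply: bdd_cst
  | |- _ =>
    first [ lazymatch goal with |- bdd (fun x => ?f (@?k x)) =>
              apply: (@bdd_comp _ _ _ f k); bdd_atom end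
          | lazymatch goal with |- bdd (fun x => ?f (@?k x) (@?l x)) =>
              apply: (@bdd_comp2 _ _ _ _ f k l); bdd_atom end
          | apply: bdd_sum => ?; bdd_tac ]
  end ].

#[global] Hint Extern 0 (bdd _) => bdd_tac : core.

Section StateTheory.
Variables (R : realType) (T : Type) (n : state R T).
Implicit Types f g u v : T -> R.

Lemma st_cst c : n (fun=> c) = c.
Proof. by rewrite -[RHS]mulr1 -(st1 n) -stZ ?mulr1. Qed.

Lemma stN f : bdd f -> n (fun x => - f x) = - n f.
Proof.
move=> bf; rewrite -mulN1r -stZ//; congr (n _); apply: funext => x.
by rewrite mulN1r.
Qed.

Lemma stB f g : bdd f -> bdd g -> n (fun x => f x - g x) = n f - n g.
Proof. by move=> bf bg; rewrite stD// stN. Qed.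

Lemma stZr c f : bdd f -> n (fun x => f x * c) = n f * c.
Proof.
by move=> bf; rewrite mulrC -stZ//; congr (n _); apply: funext => x; rewrite mulrC.
Qed.

Lemma st_sum (I : Type) (s : seq I) (F : I -> T -> R) : (forall i, bdd (F i)) ->
  n (fun x => \sum_(i <- s) F i x) = \sum_(i <- s) n (F i).
Proof.
move=> bF; elim: s => [|i s IH].
  rewrite big_nil -[RHS](st_cst 0); congr (n _).
  by apply: funext => x; rewrite big_nil.
rewrite big_cons -IH -stD//.
by congr (n _); apply: funext => x; rewrite big_cons.
Qed.

Lemma st_le f g : bdd f -> bdd g -> (forall x, f x <= g x) -> n f <= n g.
Proof.
move=> bf bg fg; rewrite -subr_ge0 -stB//; apply: st_ge0 => // x.
by rewrite subr_ge0.
Qed.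

Lemma st_norm_le f g : bdd f -> bdd g -> (forall x, `|f x| <= g x) -> `|n f| <= n g.
Proof.
move=> bf bg fg; rewrite ler_norml -stN//; apply/andP; split; apply: st_le => // x.
  by have := fg x; rewrite ler_norml => /andP[].
by rewrite (le_trans (ler_norm _)).
Qed.

Lemma st_bound f M : (forall x, `|f x| <= M) -> `|n f| <= M.
Proof.
move=> h; rewrite -[leRHS]st_cst; apply: st_norm_le => //.
exact: bdd_by h.
Qed.

Lemma st_CS u v : bdd u -> bdd v ->
  n (fun x => u x * v x) ^+ 2 <= n (fun x => u x ^+ 2) * n (fun x => v x ^+ 2).
Proof.
move=> bu bv.
set A := n (fun x => u x ^+ 2); set B := n (fun x => u x * v x).
set C := n (fun x => v x ^+ 2).
have key t : 0 <= A - 2 * t * B + t ^+ 2 * C.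
  have -> : A - 2 * t * B + t ^+ 2 * C = n (fun x => (u x - t * v x) ^+ 2).
    rewrite /A /B /C -!stZ// -stB// -stD//; congr (n _).
    by apply: funext => x; ring.
  by apply: st_ge0 => // x; rewrite sqr_ge0.
have A0 : 0 <= A by apply: st_ge0 => // x; rewrite sqr_ge0.
have : 0 <= C by apply: st_ge0 => // x; rewrite sqr_ge0.
rewrite le_eqVlt => /predU1P[C0|C0].
  rewrite -C0 mulr0; have [->|B0] := eqVneq B 0; first by rewrite expr0n.
  (* With [C = 0] the quadratic in [key] is affine in [t]; this [t] gives it the value -1. *)
  have := key ((A + 1) / (2 * B)); rewrite -C0 mulr0 addr0.
  have -> : A - 2 * ((A + 1) / (2 * B)) * B = -1 by field.
  by rewrite ler0N1.
have := key (B / C).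
have -> : A - 2 * (B / C) * B + (B / C) ^+ 2 * C = (A * C - B ^+ 2) / C.
  by field; rewrite gt_eqF.
by rewrite pmulr_lge0 ?invr_gt0// subr_ge0.
Qed.

Lemma st_sqr_ge0 u : bdd u -> 0 <= n (fun x => u x ^+ 2).
Proof. by move=> bu; apply: st_ge0 => // x; rewrite sqr_ge0. Qed.

End StateTheory.

Section StateConstr.
Variable R : realType.

#[local] Obligation Tactic := idtac.

(** The order matters: [m] acts first, in the second variable, and iterated means need not
    commute. *)
Program Definition prod_st (T T' : Type) (n : state R T) (m : state R T') : state R (T * T') :=
  @State R (T * T')%type (fun F => n (fun x => m (fun y => F (x, y)))) _ _ _ _.
Next Obligation.
move=> T T' n m f g bf bg; rewrite -stD//; congr (n _); apply: funext => x.
by rewrite stD.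
Qed.
Next Obligation.
move=> T T' n m c f bf; rewrite -stZ//; congr (n _); apply: funext => x.
by rewrite stZ.
Qed.
Next Obligation.
by move=> T T' n m f bf f0; apply: st_ge0 => // x; apply: st_ge0.
Qed.
Next Obligation. by move=> T T' n m; rewrite /= !st_cst. Qed.

Program Definition push_st (T T' : Type) (k : T -> T') (n : state R T) : state R T' :=
  @State R T' (fun F => n (fun x => F (k x))) _ _ _ _.
Next Obligation. by move=> T T' k n f g bf bg; rewrite /= stD. Qed.
Next Obligation. by move=> T T' k n c f bf; rewrite /= stZ. Qed.
Next Obligation. by move=> T T' k n f bf f0; apply: st_ge0 => /=. Qed.
Next Obligation. by move=> T T' k n; rewrite /= st_cst. Qed.

End StateConstr.

(** * Invariant means *)

Section Means.
Variables (R : realType) (G : zmodType).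
Implicit Types (c : R) (f g b : G -> R) (n m : state R G).

Definition invariant n := forall f t, bdd f -> n (fun x => f (x + t)) = n f.

(** The list may repeat entries, as happens for sums of two lists and for multiples of a torsion
    element. *)
Definition avg_le f (c : R) := exists2 s : seq G, s != [::] &
  forall x, \sum_(a <- s) f (x + a) <= c * (size s)%:R.

(** The largest value at [f] of an invariant mean, expressed without means: a bound by
    [inv_le_upper_mean], attained by [exists_extremal]. *)
Definition upper_mean f : R := inf [set c : R | avg_le f c].
Local Notation up := upper_mean.

Lemma size_gt0r (s : seq G) : s != [::] -> 0 < (size s)%:R :> R.
Proof. by case: s => // a s _; rewrite ltr0n. Qed.

Lemma upper_mean_le f c : bdd f -> avg_le f c -> up f <= c.
Proof.
move=> [M hM] hc; apply: ge_inf => //; exists (- M) => c' [s s0 hs].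
rewrite -(ler_pM2r (size_gt0r s0)) (le_trans _ (hs 0))//.
rewrite mulrC.
rewrite (_ : _ * _ = \sum_(a <- s) - M); last first.
  by rewrite big_const_seq iter_addr addr0 count_predT mulr_natl.
by apply: ler_sum => a _; have := hM (0 + a); rewrite ler_norml => /andP[].
Qed.

Lemma avg_le_pt f c : (forall x, f x <= c) -> avg_le f c.
Proof.
by move=> h; exists [:: 0] => // x; rewrite big_seq1 addr0 mulr1.
Qed.

Lemma upper_mean_ge f c : bdd f -> (forall c', avg_le f c' -> c <= c') -> c <= up f.
Proof.
move=> [M hM] h; apply: lb_le_inf => //; exists M; apply: avg_le_pt => x.
exact: le_trans (ler_norm _) (hM x).
Qed.

(** If the translates in [s] serve [f] and those in [t] serve [g], the sums [a + a'] serve both, as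
    [G] is commutative. *)
Lemma upper_meanD f g : bdd f -> bdd g -> up (fun x => f x + g x) <= up f + up g.
Proof.
move=> bf bg; rewrite -lerBlDr; apply: upper_mean_ge => // c [s s0 hs].
rewrite lerBlDr -lerBlDl; apply: upper_mean_ge => // d [t t0 ht].
rewrite lerBlDl; apply: upper_mean_le => //.
exists [seq a + a' | a <- s, a' <- t].
  by rewrite -size_eq0 size_allpairs muln_eq0 !size_eq0 negb_or s0.
move=> x; rewrite big_allpairs_dep size_allpairs natrM mulrDl /=.
have -> : \sum_(a <- s) \sum_(a' <- t) (f (x + (a + a')) + g (x + (a + a'))) =
  \sum_(a' <- t) \sum_(a <- s) f (x + a' + a) + \sum_(a <- s) \sum_(a' <- t) g (x + a + a').
  rewrite [X in _ = X + _]exchange_big -big_split /=; apply: eq_bigr => a _.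
  rewrite -big_split /=; apply: eq_bigr => a' _.
  by rewrite !addrA [x + a' + a]addrAC.
apply: lerD.
- rewrite mulrA; apply: (@le_trans _ _ (\sum_(a' <- t) c * (size s)%:R)); first by apply: ler_sum => a' _; exact: hs.
  by rewrite big_const_seq iter_addr addr0 count_predT -[leLHS]mulr_natr.
- rewrite [(size s)%:R * _]mulrC mulrA; apply: (@le_trans _ _ (\sum_(a <- s) d * (size t)%:R)); first by apply: ler_sum => a' _; exact: ht.
  by rewrite big_const_seq iter_addr addr0 count_predT -[leLHS]mulr_natr.
Qed.

Lemma upper_meanZ t f : 0 < t -> bdd f -> up (fun x => t * f x) <= t * up f.
Proof.
move=> t0 bf; rewrite -ler_pdivrMl//; apply: upper_mean_ge => // c [s s0 hs].
rewrite ler_pdivrMl//; apply: upper_mean_le => //; exists s => // x.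
by rewrite -mulr_sumr -mulrA ler_pM2l.
Qed.

(** Averaging over the multiples [t *+ i] with [i <= N] telescopes, leaving at most
    [2 * M / N.+1]. *)
Lemma upper_mean_shift f t : bdd f -> up (fun x => f (x + t) - f x) <= 0.
Proof.
move=> bf; have [M M0 hM] := bdd_gt0 bf.
apply/ler_addgt0Pr => e e0; rewrite add0r.
have [N hN] : exists N, 2 * M / e < N.+1%:R.
  by exists (Num.truncn (2 * M / e)); exact: truncnS_gt.
apply: upper_mean_le => //; exists [seq t *+ i | i <- iota 0 N.+1] => // x.
rewrite big_map size_map size_iota.
have -> : \sum_(i <- iota 0 N.+1) (f (x + t *+ i + t) - f (x + t *+ i)) =
   f (x + t *+ N.+1) - f x.
  have := @telescope_sumr _ 0 N.+1 (fun i => f (x + t *+ i)) isT.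
  rewrite mulr0n addr0 /index_iota subn0 => <-.
  by apply: eq_bigr => i _; rewrite mulrSr addrA.
have := hM (x + t *+ N.+1); have := hM x; rewrite !ler_norml => /andP[h1 h2] /andP[h3 h4].
have : 2 * M < e * N.+1%:R by rewrite -ltr_pdivrMl// mulrC.
by lra.
Qed.

Lemma inv_le_upper_mean n f : invariant n -> bdd f -> n f <= up f.
Proof.
move=> hn bf; apply: upper_mean_ge => // c [s s0 hs].
rewrite -(ler_pM2r (size_gt0r s0)).
have -> : n f * (size s)%:R = n (fun x => \sum_(a <- s) f (x + a)).
  rewrite st_sum//.
  under eq_bigr do rewrite hn//.
  by rewrite big_const_seq iter_addr addr0 count_predT mulr_natr.
by rewrite -[leRHS](st_cst n); apply: st_le.
Qed.

(* The invariant means below [q] form a face of the set of all invariant means; this is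
   what makes a minimal [q], which is linear, an extreme point. *)
Definition face (q : (G -> R) -> R) := forall m1 m2, invariant m1 -> invariant m2 ->
  (forall f, bdd f -> m1 f + m2 f <= 2 * q f) -> forall f, bdd f -> m1 f <= q f.

(** The bound by [up] encodes positivity, normalization and invariance: a linear functional below
    [up] has all three. *)
Definition subl (q : (G -> R) -> R) := [/\
  forall f g, bdd f -> bdd g -> q (fun x => f x + g x) <= q f + q g,
  forall t f, 0 < t -> bdd f -> q (fun x => t * f x) <= t * q f,
  forall f, bdd f -> q f <= up f &
  face q].

Lemma subl_up : subl up.
Proof.
split=> //; [exact: upper_meanD|exact: upper_meanZ|].
by move=> m1 m2 h1 h2 _ f bf; exact: inv_le_upper_mean.
Qed.

Section Sublinear.
Variable q : (G -> R) -> R.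
Hypothesis hq : subl q.

Lemma subl0 : q (fun=> 0) = 0.
Proof.
case: hq => qD qZ qup _; apply/eqP; rewrite eq_le; apply/andP; split.
  apply: le_trans (qup _ _) _ => //; apply: upper_mean_le => //.
  exact: avg_le_pt.
have := qD (fun=> 0) (fun=> 0) (bdd_cst _ _) (bdd_cst _ _).
rewrite (_ : (fun=> 0 + 0) = (fun=> 0)); last by apply: funext => x; rewrite addr0.
by lra.
Qed.

Lemma sublZ t f : 0 <= t -> bdd f -> q (fun x => t * f x) = t * q f.
Proof.
move=> + bf; rewrite le_eqVlt => /predU1P[<-|t0].
  rewrite mul0r -[RHS]subl0; congr (q _).
  by apply: funext => x; rewrite mul0r.
case: hq => qD qZ qup _; apply/eqP; rewrite eq_le qZ//=.
rewrite -ler_pdivlMl//; have btf : bdd (fun x => t * f x) by [].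
have := qZ t^-1 _ _ btf; rewrite invr_gt0 => /(_ t0).
by congr (q _ <= _); apply: funext => x; rewrite mulKf// gt_eqF.
Qed.

Lemma sublN f : bdd f -> 0 <= q f + q (fun x => - f x).
Proof.
move=> bf; case: hq => qD _ _ _; rewrite -subl0.
apply: le_trans (qD _ _ _ _) => //.
by rewrite le_eqVlt; apply/orP; left; apply/eqP; congr (q _); apply: funext => x; rewrite subrr.
Qed.

Variable b : G -> R.
Hypothesis bb : bdd b.

(* Passing to the directional derivative of [q] at [b] keeps only the means maximal at [b]. *)
Definition dirder f : R := inf [set q (fun x => f x + t * b x) - t * q b | t in [set t : R | 0 <= t]].

Lemma dirder_le t f : bdd f -> 0 <= t -> dirder f <= q (fun x => f x + t * b x) - t * q b.
Proof.
move=> bf t0; apply: ge_inf; last by exists t.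
(* Lower bound from [u * q b = q (u * b) <= q (f + u * b) + q (- f)]. *)
exists (- q (fun x => - f x)) => _ [u /= u0 <-].
case: hq => qD _ _ _.
rewrite lerBrDl -sublZ// lerBlDr.
apply: le_trans (qD _ _ _ _) => //.
by rewrite le_eqVlt; apply/orP; left; apply/eqP; congr (q _); apply: funext => x; ring.
Qed.

Lemma dirder_ge c f : (forall t, 0 <= t -> c <= q (fun x => f x + t * b x) - t * q b) ->
  c <= dirder f.
Proof.
move=> h; apply: lb_le_inf.
  by exists (q (fun x => f x + 0 * b x) - 0 * q b); exists 0 => //=.
by move=> _ [t /= t0 <-]; exact: h.
Qed.

Lemma dirder_le_id f : bdd f -> dirder f <= q f.
Proof.
move=> bf; apply: le_trans (dirder_le bf (lexx 0)) _.
rewrite mul0r subr0 le_eqVlt; apply/orP; left; apply/eqP; congr (q _).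
by apply: funext => x; rewrite mul0r addr0.
Qed.

(** This is the bound at [t = 1]. It forces every linear functional below [dirder] to be at least
    [q b] at [b]. *)
Lemma dirder_opp : dirder (fun x => - b x) <= - q b.
Proof.
apply: le_trans (@dirder_le 1 _ _ _) _ => //.
rewrite mul1r -[leRHS]add0r lerD2r -subl0 le_eqVlt; apply/orP; left; apply/eqP; congr (q _).
by apply: funext => x; rewrite mul1r addNr.
Qed.

Lemma subl_dirder : subl dirder.
Proof.
case: (hq) => qD qZ qup qf; split.
- move=> f g bf bg; rewrite -lerBlDr; apply: dirder_ge => t t0.
  rewrite lerBlDr -lerBlDl; apply: dirder_ge => u u0.
  rewrite lerBlDl; apply: le_trans (@dirder_le (t + u) _ _ _) _ => //; first by rewrite addr_ge0.
  have := qD (fun x => f x + t * b x) (fun x => g x + u * b x).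
  rewrite (_ : (fun x => f x + t * b x + (g x + u * b x)) = (fun x => f x + g x + (t + u) * b x)).
    by move=> /(_ ltac:(done) ltac:(done)); lra.
  by apply: funext => x; ring.
- move=> t f t0 bf; rewrite -ler_pdivrMl//; apply: dirder_ge => u u0.
  rewrite ler_pdivrMl//; apply: le_trans (@dirder_le (t * u) _ _ _) _ => //.
    by rewrite mulr_ge0// ltW.
  rewrite mulrBr mulrA lerD2r.
  have := qZ t (fun x => f x + u * b x) t0 ltac:(done).
  by congr (q _ <= _); apply: funext => x; ring.
- by move=> f bf; rewrite (le_trans (dirder_le_id bf))// qup.
(* By the face property of [q], both means lie below [q]. At [- b] the hypothesis then forces
   [m1 b >= q b], and subtracting [t * m1 b] from [m1 (f + t * b)] gives the bound. *)
- move=> m1 m2 i1 i2 h12.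
  have h12' f : bdd f -> m1 f + m2 f <= 2 * q f.
    by move=> bf; rewrite (le_trans (h12 f bf))// ler_pM2l// dirder_le_id.
  have l1 := qf m1 m2 i1 i2 h12'.
  have l2 : forall f, bdd f -> m2 f <= q f.
    by apply: (qf m2 m1 i2 i1) => f bf; rewrite addrC h12'.
  have m1b : q b <= m1 b.
    have := h12 (fun x => - b x) ltac:(done); rewrite !stN//.
    by have := dirder_opp; have := l2 b bb; lra.
  move=> f bf; apply: dirder_ge => t t0.
  have := l1 (fun x => f x + t * b x) ltac:(done); rewrite stD// stZ//.
  have : t * q b <= t * m1 b by rewrite ler_wpM2l.
  by lra.
Qed.

End Sublinear.

Definition extremal m := forall m1 m2, invariant m1 -> invariant m2 ->
  (forall f, bdd f -> m1 f + m2 f = 2 * m f) -> forall f, bdd f -> m1 f = m f.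

Section Existence.
Variable b : G -> R.
Hypothesis bb : bdd b.

(** The second clause pins the value at [b]: a linear [q] satisfying it takes the value [up b]
    there. *)
Let good q := subl q /\ q (fun x => - b x) <= - up b.
(** The order is reversed, so that a maximal element in Zorn's lemma is a minimal functional. *)
Let below (q1 q2 : {q | good q}) : bool :=
  `[< forall f, bdd f -> sval q2 f <= sval q1 f >].

(** The pointwise infimum stays subadditive because, of two members of a chain, the smaller one
    serves both functions. *)
Let chain_inf (A : set {q | good q}) : total_on A below ->
  exists t, forall s, A s -> below s t.
Proof.
move=> tot; have [[q0 Aq0]|A0] := pselect (A !=set0); last first.
  have gup : good (dirder up b) by split; [exact: subl_dirder subl_up _ _|exact: dirder_opp subl_up _ _].
  by exists (exist _ _ gup) => s As; exfalso; apply: A0; exists s.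
pose Q f := inf [set sval q f | q in A].
have Qle q f : A q -> bdd f -> Q f <= sval q f.
  move=> Aq bf; apply: ge_inf; last by exists q.
  exists (- up (fun x => - f x)) => _ [[r [hr hrb]] /= Ar <-].
  have := sublN hr bf; case: (hr) => _ _ /(_ (fun x => - f x)) h _.
  by have := h ltac:(done); lra.
have Qge c f : (forall q, A q -> c <= sval q f) -> c <= Q f.
  by move=> h; apply: lb_le_inf; [exists (sval q0 f); exists q0|move=> _ [q Aq <-]; exact: h].
suff gQ : good Q.
  by exists (exist _ _ gQ) => s As; apply/asboolP => f bf /=; exact: Qle.
split; last first.
  by apply: le_trans (Qle _ _ Aq0 _) _ => //; case: (svalP q0).
split.
- move=> f g bf bg; rewrite -lerBlDr; apply: (Qge) => q Aq.
  rewrite lerBlDr -lerBlDl; apply: (Qge) => r Ar; rewrite lerBlDl.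
  have [/asboolP h|/asboolP h] := tot q r Aq Ar.
    apply: le_trans (Qle r _ Ar _) _ => //.
    case: (svalP r) => -[+ _ _ _] _ => /(_ f g bf bg) /le_trans; apply.
    by rewrite lerD2r h.
  apply: le_trans (Qle q _ Aq _) _ => //.
  case: (svalP q) => -[+ _ _ _] _ => /(_ f g bf bg) /le_trans; apply.
  by rewrite lerD2l h.
- move=> t f t0 bf; rewrite -ler_pdivrMl//; apply: (Qge) => q Aq.
  rewrite ler_pdivrMl//; apply: le_trans (Qle q _ Aq _) _ => //.
  by case: (svalP q) => -[_ + _ _] _; apply.
- move=> f bf; apply: le_trans (Qle _ _ Aq0 bf) _.
  by case: (svalP q0) => -[_ _ + _] _; apply.
- move=> m1 m2 i1 i2 h12 f bf; apply: (Qge) => q Aq.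
  case: (svalP q) => -[_ _ _ +] _ => /(_ m1 m2 i1 i2); apply=> // g bg.
  by rewrite (le_trans (h12 g bg))// ler_pM2l// Qle.
Qed.

Lemma exists_extremal : exists m, [/\ invariant m, extremal m & m b = up b].
Proof.
have gup : good (dirder up b) by split; [exact: subl_dirder subl_up _ _|exact: dirder_opp subl_up _ _].
have [|q1 q2 q3 /asboolP h12 /asboolP h23||[q [hq qb]] qmax] :=
  @ZL_preorder _ (exist _ _ gup) below.
- by move=> t; apply/asboolP.
- by apply/asboolP => f bf; rewrite (le_trans (h23 _ bf))// h12.
- exact: chain_inf.
(* Minimality gives [q <= dirder q f]; at [- f] this reads [q (- f) <= - q f], which makes [q] odd
   and then linear. *)
have qN f : bdd f -> q (fun x => - f x) = - q f.
  move=> bf; have gd : good (dirder q f).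
    split; first exact: subl_dirder.
    by rewrite (le_trans _ qb)// dirder_le_id.
  have := qmax (exist _ _ gd).
  have -> : below (exist _ q (conj hq qb)) (exist _ _ gd).
    by apply/asboolP => g bg /=; exact: dirder_le_id.
  move=> /(_ erefl) /asboolP /= /(_ (fun x => - f x) ltac:(done)).
  have := dirder_opp hq bf; have := sublN hq bf; lra.
case: (hq) => qD qZ qup qf.
have qDE f g : bdd f -> bdd g -> q (fun x => f x + g x) = q f + q g.
  move=> bf bg; apply/eqP; rewrite eq_le qD//=.
  have := qD (fun x => f x + g x) (fun x => - g x) ltac:(done) ltac:(done).
  rewrite qN// (_ : (fun x => f x + g x - g x) = f); first by lra.
  by apply: funext => x; rewrite addrK.
have qZE c f : bdd f -> q (fun x => c * f x) = c * q f.
  move=> bf; have [c0|c0] := leP 0 c; first exact: sublZ.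
  rewrite -[c]opprK mulNr -sublZ ?oppr_ge0 ?ltW// -qN//; congr (q _).
  by apply: funext => x; rewrite mulNr.
have q0 f : bdd f -> (forall x, 0 <= f x) -> 0 <= q f.
  move=> bf f0; rewrite -oppr_le0 -qN//; apply: le_trans (qup _ _) _ => //.
  by apply: upper_mean_le => //; apply: avg_le_pt => x; rewrite oppr_le0.
have q1 : q (fun=> 1) = 1.
  apply/eqP; rewrite eq_le; apply/andP; split.
    by apply: le_trans (qup _ _) _ => //; apply: upper_mean_le => //; exact: avg_le_pt.
  rewrite -lerN2 -qN//; apply: le_trans (qup _ _) _ => //; apply: upper_mean_le => //.
  exact: avg_le_pt.
have inv_le f t : bdd f -> q (fun x => f (x + t)) <= q f.
  move=> bf; rewrite -subr_le0 -qN// -qDE//.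
  by apply: le_trans (qup _ _) _ => //; exact: upper_mean_shift.
exists (State qDE qZE q0 q1); split => //.
- move=> f t bf /=; apply/eqP; rewrite eq_le inv_le//=.
  have := @inv_le (fun x => - f x) t ltac:(done).
  by rewrite !qN// lerN2.
- move=> m1 m2 i1 i2 h12 f bf /=.
  have le12 g : bdd g -> m1 g <= q g.
    by apply: (qf m1 m2) => // {}g bg; rewrite h12.
  apply/eqP; rewrite eq_le le12//=.
  by have := le12 (fun x => - f x) ltac:(done); rewrite stN// qN// lerN2.
- by rewrite /=; apply/eqP; rewrite eq_le qup//= -lerN2 -qN.
Qed.

End Existence.

Definition ergodic m := forall n, invariant n -> forall b f, bdd b -> bdd f ->
  n (fun g : G => m (fun x => b x * f (x + g))) = m b * m f.

Section Ergodic.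
Variables m n : state R G.
Hypotheses (im : invariant m) (inn : invariant n) (em : extremal m).

(* For [0 <= f <= 1], [m] is the midpoint of the invariant means [m + D] and [m - D], where
   [D b = n_g m(b * T_g f) - m f * m b]; extremality gives [D = 0]. *)
Section Perturb.
Variable f : G -> R.
Hypotheses (bf : bdd f) (f01 : forall x, 0 <= f x <= 1).

Let D b := n (fun g : G => m (fun x => b x * f (x + g))) - m f * m b.

(** Both terms of [D b] lie between 0 and [m b]; this makes [m + s * D] positive when [|s| <= 1]. *)
Let D_bound b : bdd b -> (forall x, 0 <= b x) -> `|D b| <= m b.
Proof.
move=> bb b0; rewrite /D ler_norml.
have mf0 : 0 <= m f by apply: st_ge0 => // x; case/andP: (f01 x).
have mf1 : m f <= 1.
  by rewrite -(st1 m); apply: st_le => // x; case/andP: (f01 x).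
have mb0 : 0 <= m b by exact: st_ge0.
have mfb : m f * m b <= m b by rewrite ler_piMl.
have mfb0 : 0 <= m f * m b by rewrite mulr_ge0.
have h0 : 0 <= n (fun g : G => m (fun x => b x * f (x + g))).
  apply: st_ge0 => // g; apply: st_ge0 => // x; rewrite mulr_ge0//.
  by case/andP: (f01 (x + g)).
have h1 : n (fun g : G => m (fun x => b x * f (x + g))) <= m b.
  rewrite -[leRHS](st_cst n); apply: st_le => // g; apply: st_le => // x.
  by rewrite ler_piMr//; case/andP: (f01 (x + g)).
by lra.
Qed.

Program Definition perturb (s : R) (hs : `|s| <= 1) : state R G :=
  @State R G (fun b => m b + s * D b) _ _ _ _.
Next Obligation.
move=> s hs u v bu bv; rewrite /D stD//.
rewrite (_ : (fun g : G => _) = (fun g : G => m (fun x => u x * f (x + g)) + m (fun x => v x * f (x + g)))).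
  by rewrite stD//; ring.
apply: funext => g; rewrite -stD//; congr (m _); apply: funext => x; ring.
Qed.
Next Obligation.
move=> s hs c u bu; rewrite /D stZ//.
rewrite (_ : (fun g : G => _) = (fun g : G => c * m (fun x => u x * f (x + g)))).
  by rewrite stZ//; ring.
by apply: funext => g; rewrite -stZ//; congr (m _); apply: funext => x; ring.
Qed.
Next Obligation.
move=> s hs u bu u0; have := D_bound bu u0 => hD.
have : `|s * D u| <= m u.
  by rewrite normrM (le_trans _ hD)// ler_piMl.
by rewrite ler_norml => /andP[]; lra.
Qed.
Next Obligation.
move=> s hs; rewrite /D st1 mulr1 (_ : n _ = m f) ?subrr ?mulr0 ?addr0//.
rewrite -[RHS](st_cst n); congr (n _); apply: funext => g.
rewrite -(@im f g)//; congr (m _); apply: funext => x; by rewrite mul1r.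
Qed.

Lemma perturb_inv s hs : invariant (@perturb s hs).
Proof.
move=> b t bb /=; congr (_ + s * _); first exact: im.
rewrite /D im//; congr (_ - _).
rewrite -(@inn _ t)//; congr (n _); apply: funext => g.
rewrite -[RHS](@im (fun x => b x * f (x + g)) t)//; congr (m _).
by apply: funext => x; rewrite addrAC addrA.
Qed.

Lemma ergodic_unit b : bdd b -> n (fun g : G => m (fun x => b x * f (x + g))) = m b * m f.
Proof.
move=> bb.
have h1 : `|1 : R| <= 1 by rewrite normr1.
have h2 : `|- 1 : R| <= 1 by rewrite normrN normr1.
have h : m b + 1 * D b = m b.
  apply: (em (@perturb_inv _ h1) (@perturb_inv _ h2)) => // u bu /=.
  by ring.
by move: h; rewrite /D; lra.
Qed.

End Perturb.

Lemma ergodicE b f : bdd b -> bdd f ->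
  n (fun g : G => m (fun x => b x * f (x + g))) = m b * m f.
Proof.
move=> bb bf; have [M M0 hM] := bdd_gt0 bf.
have := @ergodic_unit (fun x => (2 * M)^-1 * (f x + M)) ltac:(done) _ b bb.
have M2 : 0 < 2 * M by rewrite mulr_gt0.
rewrite (_ : (fun g : G => _) = (fun g : G => (2 * M)^-1 * (m (fun x => b x * f (x + g)) + M * m b))).
  rewrite !stZ// !stD// !st_cst//= => h.
  suff: (2 * M) * ((2 * M)^-1 * (n (fun g : G => m (fun x => b x * f (x + g))) + M * m b)) =
        (2 * M) * (m b * ((2 * M)^-1 * (m f + M))).
    by rewrite mulVKf ?gt_eqF// mulrCA mulVKf ?gt_eqF//; lra.
  rewrite h// => x; have := hM x; rewrite ler_norml => /andP[h1 h2].
  by rewrite mulr_ge0 ?invr_ge0 ?(ltW M2)//= ?ler_pdivrMl//; lra.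
apply: funext => g; rewrite -stZ// -stD// -stZ//; congr (m _).
by apply: funext => x; ring.
Qed.

End Ergodic.

Lemma extremal_ergodic m : invariant m -> extremal m -> ergodic m.
Proof. by move=> im em n inn b f bb bf; exact: ergodicE. Qed.

End Means.

(** * The mean-square seminorm of a state *)

Section Norm2.
Variables (R : realType) (T : Type) (n : state R T).
Implicit Types u v : T -> R.

Definition norm2 u : R := Num.sqrt (n (fun x => u x ^+ 2)).

Lemma norm2_ge0 u : 0 <= norm2 u.
Proof. exact: sqrtr_ge0. Qed.

Lemma sqr_norm2 u : bdd u -> norm2 u ^+ 2 = n (fun x => u x ^+ 2).
Proof. by move=> bu; rewrite sqr_sqrtr// st_sqr_ge0. Qed.

Lemma norm2_CS u v : bdd u -> bdd v -> `|n (fun x => u x * v x)| <= norm2 u * norm2 v.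
Proof.
move=> bu bv; rewrite -(@ler_pXn2r _ 2)// ?nnegrE ?mulr_ge0 ?norm2_ge0//.
by rewrite exprMn !sqr_norm2// real_normK ?num_real// st_CS.
Qed.

Lemma norm2D u v : bdd u -> bdd v -> norm2 (fun x => u x + v x) <= norm2 u + norm2 v.
Proof.
move=> bu bv; rewrite -(@ler_pXn2r _ 2)// ?nnegrE ?addr_ge0 ?norm2_ge0//.
rewrite sqrrD !sqr_norm2//.
rewrite (_ : n _ = n (fun x => u x ^+ 2) + n (fun x => u x * v x) *+ 2 + n (fun x => v x ^+ 2)).
  by rewrite lerD2r lerD2l lerMn2r/= (le_trans (ler_norm _))// norm2_CS.
rewrite -mulr_natr -stZr// -!stD//; congr (n _).
by apply: funext => x; rewrite sqrrD mulr_natr.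
Qed.

Lemma norm2Z c u : bdd u -> norm2 (fun x => c * u x) = `|c| * norm2 u.
Proof.
move=> bu; rewrite /norm2 (_ : (fun x => _) = (fun x => c ^+ 2 * u x ^+ 2)).
  by rewrite stZ// sqrtrM ?sqr_ge0// sqrtr_sqr.
by apply: funext => x; rewrite exprMn.
Qed.

Lemma norm2_bound u M : (forall x, `|u x| <= M) -> 0 <= M -> norm2 u <= M.
Proof.
move=> h M0; rewrite -(@ler_pXn2r _ 2)// ?nnegrE ?norm2_ge0// sqr_norm2; last exact: bdd_by h.
apply: le_trans (ler_norm _) _; apply: st_bound => x.
by rewrite normrX lerXn2r ?nnegrE.
Qed.

Lemma norm2_sum (I : eqType) (s : seq I) (F : I -> T -> R) (e : R) : (forall i, bdd (F i)) ->
  (forall i, i \in s -> norm2 (F i) <= e) ->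
  norm2 (fun x => \sum_(i <- s) F i x) <= (size s)%:R * e.
Proof.
move=> bF; elim: s => [_|i s IH h].
  rewrite mul0r; apply: norm2_bound => // x.
  by rewrite big_nil normr0.
rewrite (_ : (fun x => _) = (fun x => F i x + \sum_(j <- s) F j x)); last first.
  by apply: funext => x; rewrite big_cons.
apply: le_trans (norm2D _ _) _ => //=.
rewrite -natr1 mulrDl mul1r addrC lerD//; last by apply: h; rewrite mem_head.
by apply: IH => j js; apply: h; rewrite in_cons js orbT.
Qed.

Lemma norm1_le_norm2 u : bdd u -> `|n u| <= norm2 u.
Proof.
move=> bu; have := @norm2_CS u (fun=> 1) bu (bdd_cst _ _).
rewrite (_ : (fun x => u x * 1) = u); last by apply: funext => x; rewrite mulr1.
move=> /le_trans; apply; rewrite ler_piMr ?norm2_ge0//.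
by apply: norm2_bound => // _; rewrite normr1.
Qed.

(* One-sided control of the correlations suffices, since only the square of the sum matters. *)
Lemma exists_small_sum (I : eqType) (z : I -> T -> R) (B : I -> Prop) (M c : R) (N : nat) :
  (forall i, bdd (z i)) -> (forall i, B i -> n (fun x => z i x ^+ 2) <= M) ->
  (forall s : seq I, (size s < N)%N -> exists2 i, B i &
     n (fun x => z i x * \sum_(j <- s) z j x) <= c) ->
  exists s : seq I, [/\ size s = N, forall i, i \in s -> B i &
    n (fun x => (\sum_(j <- s) z j x) ^+ 2) <= N%:R * (M + 2 * c)].
Proof.
move=> bz hM; elim: N => [_|N IH h].
  exists [::]; split=> //; rewrite mul0r -[leRHS](st_cst n); apply: st_le => // x.
  by rewrite big_nil expr0n.
have [s [ss hs hsum]] := IH (fun s sN => h s (ltnW sN)).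
have [i Bi hi] : exists2 i, B i & n (fun x => z i x * \sum_(j <- s) z j x) <= c.
  by apply: h; rewrite ss.
exists (i :: s); split => [|j|]; first by rewrite /= ss.
  by rewrite in_cons => /predU1P[->//|]; exact: hs.
rewrite (_ : (fun x => _) = (fun x => z i x ^+ 2 + 2 * (z i x * \sum_(j <- s) z j x) +
   (\sum_(j <- s) z j x) ^+ 2)); last by apply: funext => x; rewrite big_cons; ring.
rewrite !stD// stZ// -natr1 mulrDl mul1r.
have := hM i Bi; lra.
Qed.

End Norm2.

(** * Almost periodic functions *)

Section AlmostPeriodic.
Variables (R : realType) (G : zmodType).
Implicit Types (l v w : G -> R) (n m : state R G).

Lemma finite_net (T : eqType) (s : seq T) (F : G -> T) : (forall g, F g \in s) ->
  exists K : seq G, forall g, exists2 k, k \in K & F g = F k.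
Proof.
move=> Fs.
have /choice[rep hrep] : forall v : T, exists g, (exists g', F g' = v) -> F g = v.
  move=> v; have [[g gv]|h] := pselect (exists g, F g = v); first by exists g.
  by exists 0.
exists (map rep s) => g; exists (rep (F g)); first exact: map_f.
by rewrite hrep//; exists g.
Qed.

(** Rounding each coordinate down to a grid of step [e] leaves finitely many index vectors. *)
Lemma coord_net (k : nat) (c : 'I_k -> G -> R) (e : R) : 0 < e -> (forall i g, `|c i g| <= 1) ->
  exists K : seq G, forall g, exists2 h, h \in K & forall i, `|c i g - c i h| <= e.
Proof.
move=> e0 c1; pose N := Num.truncn (2 / e).
pose F g : {ffun 'I_k -> 'I_N.+1} := [ffun i => inord (Num.truncn ((c i g + 1) / e))].
have [|K hK] := @finite_net _ (enum {ffun 'I_k -> 'I_N.+1}) F.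
  by move=> g; rewrite mem_enum.
exists K => g; have [h hh Fgh] := hK g; exists h => // i.
have c0 g' : 0 <= (c i g' + 1) / e.
  by rewrite divr_ge0// ?(ltW e0)//; have := c1 i g'; rewrite ler_norml => /andP[]; lra.
have cN g' : (Num.truncn ((c i g' + 1) / e) < N.+1)%N.
  rewrite ltnS; apply: le_truncn; rewrite ler_pM2r ?invr_gt0//.
  by have := c1 i g'; rewrite ler_norml => /andP[]; lra.
have : Num.truncn ((c i g + 1) / e) = Num.truncn ((c i h + 1) / e).
  move/ffunP: Fgh => /(_ i); rewrite !ffunE => /(congr1 val) /=.
  by rewrite !inordK.
have /andP[] := truncn_itv (c0 g); have /andP[] := truncn_itv (c0 h).
move=> a1 a2 a3 a4 E; rewrite E in a3 a4.
move: a1 a2 a3 a4; rewrite -natr1 ler_pdivlMr// ltr_pdivrMr// ler_pdivlMr// ltr_pdivrMr// !mulrDl.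
set t := _%:R * e => *; rewrite ler_norml; lra.
Qed.

(* A length function whose balls are syndetic, i.e. whose translation-invariant
   pseudometric l (x - y) is totally bounded. *)
Record tlen l : Prop := TLen {
  tlen_ge0 : forall x, 0 <= l x;
  tlenN : forall x, l (- x) = l x;
  tlenD : forall x y, l (x + y) <= l x + l y;
  tlen_tb : forall e, 0 < e -> exists K : seq G, forall g, exists2 k, k \in K & l (g - k) <= e }.

Lemma tlen_net l e : tlen l -> 0 < e -> exists K : seq G, exists z : G -> G,
  [/\ uniq K, forall g, z g \in K & forall g, l (g - z g) <= e].
Proof.
move=> hl e0; have [K hK] := tlen_tb hl e0.
have /choice[z hz] : forall g, exists k, k \in K /\ l (g - k) <= e.
  by move=> g; have [k kK lk] := hK g; exists k.
exists (undup K), z; split; first exact: undup_uniq.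
- by move=> g; rewrite mem_undup; case: (hz g).
- by move=> g; case: (hz g).
Qed.

Lemma tlen_distC l x y : tlen l -> l (x - y) = l (y - x).
Proof. by move=> hl; rewrite -opprB tlenN. Qed.

Lemma tlen_dist_triangle l z x y : tlen l -> l (x - y) <= l (x - z) + l (z - y).
Proof. by move=> hl; rewrite -(subrKA z x (- y)) tlenD. Qed.

(** The given nets live in the targets of [phi] and [psi]; keeping one [g] for each pair of net
    points that occurs gives a net in the source, with radius doubled. *)
Lemma tlen_net_pair l l' (phi psi : G -> G) (e : R) : tlen l -> tlen l' -> 0 < e ->
  exists K : seq G, forall g, exists2 k, k \in K &
    l (phi g - phi k) <= e /\ l' (psi g - psi k) <= e.
Proof.
move=> hl hl' e0; have e2 : 0 < e / 2 by rewrite divr_gt0.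
have [K [z [_ zK hz]]] := tlen_net hl e2; have [K' [z' [_ zK' hz']]] := tlen_net hl' e2.
have [g|J hJ] := @finite_net _ [seq (k, k') | k <- K, k' <- K'] (fun g => (z (phi g), z' (psi g))).
  by apply/allpairsP; exists (z (phi g), z' (psi g)); split=> /=; [exact: zK|exact: zK'|].
exists J => g; have [k kJ [E1 E2]] := hJ g; exists k => //; split.
- apply: le_trans (tlen_dist_triangle (z (phi g)) _ _ hl) _.
  rewrite [in X in _ + X]E1 (tlen_distC (z _) _ hl).
  by have := hz (phi g); have := hz (phi k); lra.
- apply: le_trans (tlen_dist_triangle (z' (psi g)) _ _ hl') _.
  rewrite [in X in _ + X]E2 (tlen_distC (z' _) _ hl').
  by have := hz' (psi g); have := hz' (psi k); lra.
Qed.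

Lemma tlen_add l l' : tlen l -> tlen l' -> tlen (fun x => l x + l' x).
Proof.
move=> hl hl'; split.
- by move=> x; rewrite addr_ge0 ?(tlen_ge0 hl) ?(tlen_ge0 hl').
- by move=> x; rewrite !tlenN.
- by move=> x y; have := tlenD hl x y; have := tlenD hl' x y; lra.
- move=> e e0; have e2 : 0 < e / 2 by rewrite divr_gt0.
  have [K hK] := tlen_net_pair id id hl hl' e2.
  by exists K => g; have [k kK [h1 h2]] := hK g; exists k => //; move: h1 h2 => /=; lra.
Qed.

Lemma tlen_scale c l : 0 <= c -> tlen l -> tlen (fun x => c * l x).
Proof.
(* Dividing by [c + 1] rather than [c] covers [c = 0]. *)
move=> c0 hl; have c1 : 0 < c + 1 by rewrite ltr_wpDl.
split.
- by move=> x; rewrite mulr_ge0 ?(tlen_ge0 hl).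
- by move=> x; rewrite (tlenN hl).
- by move=> x y; rewrite -mulrDr ler_wpM2l// (tlenD hl).
- move=> e e0; have e2 : 0 < e / (c + 1) by rewrite divr_gt0.
  have [K hK] := tlen_tb hl e2; exists K => g; have [k kK h] := hK g; exists k => //.
  have : (c + 1) * l (g - k) <= e by rewrite -ler_pdivlMl// mulrC.
  have := tlen_ge0 hl (g - k); lra.
Qed.

Lemma tlen0 : tlen (fun=> 0).
Proof.
split=> [x|x|x y|e e0]; rewrite ?addr0//.
by exists [:: 0] => g; exists 0; rewrite ?mem_head// ltW.
Qed.

Lemma tlen_bdd l : tlen l -> bdd l.
Proof.
move=> hl; have [K [z [_ zK hz]]] := tlen_net hl (@ltr01 R).
exists (1 + \sum_(k <- K) l k) => x; rewrite ger0_norm ?(tlen_ge0 hl)//.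
rewrite -[x in leLHS](subrK (z x)); apply: le_trans (tlenD hl _ _) _; rewrite lerD//.
rewrite (big_rem (z x))//= lerDl; apply: sumr_ge0 => k _; exact: tlen_ge0.
Qed.

(** Bohr almost periodicity in Bochner's form: for [l] one can take the uniform distance from [v] to
    its translates, and total boundedness is precompactness of the orbit. *)
Definition almost_periodic v := bdd v /\
  exists2 l, tlen l & forall x y, `|v x - v y| <= l (x - y).
Local Notation AP := almost_periodic.

Lemma AP_cst c : AP (fun=> c).
Proof. by split; [|exists (fun=> 0); [exact: tlen0|move=> x y; rewrite subrr normr0]]. Qed.

Lemma APD v w : AP v -> AP w -> AP (fun x => v x + w x).
Proof.
move=> [bv [l hl vl]] [bw [l' hl' wl]]; split => //.
exists (fun x => l x + l' x) => [|x y]; first exact: tlen_add.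
rewrite opprD addrACA (le_trans (ler_normD _ _))// lerD//.
Qed.

Lemma APM v w : AP v -> AP w -> AP (fun x => v x * w x).
Proof.
move=> [bv [l hl vl]] [bw [l' hl' wl]]; split => //.
have [M M0 hM] := bdd_gt0 bv; have [N N0 hN] := bdd_gt0 bw.
exists (fun x => N * l x + M * l' x) => [|x y].
  by apply: tlen_add; apply: tlen_scale => //; exact: ltW.
have -> : v x * w x - v y * w y = w x * (v x - v y) + v y * (w x - w y) by ring.
rewrite (le_trans (ler_normD _ _))// !normrM lerD// ler_pM//.
Qed.

Lemma APZ c v : AP v -> AP (fun x => c * v x).
Proof. exact: APM (AP_cst c). Qed.

Lemma AP_shift v t : AP v -> AP (fun x => v (x + t)).
Proof.
move=> [bv [l hl vl]]; split => //; exists l => // x y.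
by rewrite (le_trans (vl _ _))// opprD addrACA subrr addr0.
Qed.

Lemma clamp_lip (a b : R) :
  `|Num.max 0 (Num.min 1 a) - Num.max 0 (Num.min 1 b)| <= `|a - b|.
Proof.
have := ler_norm (a - b); have := ler_norm (- (a - b)); rewrite normrN => h1 h2.
rewrite ler_norml /Num.max /Num.min.
case: (ltP 1 a) => ?; case: (ltP 1 b) => ?; do 2 ?[case: ltP => ?]; lra.
Qed.

Lemma AP_clamp v : AP v -> AP (fun x => Num.max 0 (Num.min 1 (v x))).
Proof.
move=> [bv [l hl vl]]; split => //; exists l => // x y.
exact: le_trans (clamp_lip _ _) (vl x y).
Qed.

(** The translates of [w] by [K] sum to at least [c] everywhere; so a nonnegative function bounded
    below on a syndetic set has positive mean. *)
Lemma invariant_lower n w c (K : seq G) : invariant n -> bdd w -> (forall x, 0 <= w x) ->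
  (forall g, exists2 k, k \in K & c <= w (g - k)) -> c <= (size K)%:R * n w.
Proof.
move=> inn bw w0 h.
have -> : (size K)%:R * n w = n (fun x => \sum_(k <- K) w (x - k)).
  rewrite st_sum//; under eq_bigr do rewrite inn//.
  by rewrite big_const_seq iter_addr addr0 count_predT mulr_natl.
rewrite -[leLHS](st_cst n); apply: st_le => // x; have [k kK hk] := h x.
rewrite (big_rem k)//= (le_trans hk)// lerDl; apply: sumr_ge0 => i _; exact: w0.
Qed.

Section Fubini.
Variables m n : state R G.
Hypotheses (em : ergodic m) (inn : invariant n).

(* Iterated means do not commute in general; ergodicity of [m] is what allows the exchange. *)
Lemma fubini_fin (c : G -> R) (H : G -> G -> R) (z : G -> G) (K : seq G) :
  bdd c -> bdd (fun p => H p.1 p.2) -> uniq K -> (forall x, z x \in K) ->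
  n (fun t => m (fun x => c x * H (z x) (x + t))) = m (fun x => c x * m (H (z x))).
Proof.
move=> bc bH uK zK.
have bHk k : bdd (H k) by exact: (bdd_comp2 (fun=> k) id).
have sel (F : G -> R) x : F (z x) = \sum_(k <- K) (z x == k)%:R * F k.
  rewrite (bigD1_seq (z x))//= eqxx mul1r big1 ?addr0// => k kz.
  by rewrite eq_sym (negbTE kz) mul0r.
transitivity (n (fun t => \sum_(k <- K) m (fun x => c x * (z x == k)%:R * H k (x + t)))).
  congr (n _); apply: funext => t; rewrite -st_sum//; congr (m _); apply: funext => x.
  by rewrite (sel (fun k => H k (x + t)))// mulr_sumr; apply: eq_bigr => k _; rewrite mulrA.
rewrite st_sum//.
under eq_bigr do rewrite em//.
rewrite (_ : m _ = m (fun x => \sum_(k <- K) c x * (z x == k)%:R * m (H k))).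
  rewrite st_sum//; apply: eq_bigr => k _; by rewrite stZr.
congr (m _); apply: funext => x; rewrite (sel (fun k => m (H k)))// mulr_sumr.
by apply: eq_bigr => k _; rewrite mulrA.
Qed.

(** For invariant [m] this is the weighted average [m (fun t => w t * f (x + t))]. Here [x] enters
    only through [w], so regularity of [w] passes to the average. *)
Definition smooth (w f : G -> R) x := m (fun y => f y * w (y - x)).

Lemma smooth_bdd w f : bdd w -> bdd f -> bdd (smooth w f).
Proof. by move=> bw bf; rewrite /smooth. Qed.

Lemma smooth_lip w f l M : bdd w -> bdd f -> tlen l -> (forall x, `|f x| <= M) ->
  (forall x y, `|w x - w y| <= l (x - y)) ->
  forall x y, `|smooth w f x - smooth w f y| <= M * l (x - y).
Proof.
move=> bw bf hl hM wl x y; rewrite /smooth -stB//; apply: st_bound => t.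
rewrite -mulrBr normrM ler_pM// (le_trans (wl _ _))//.
by rewrite opprD addrACA subrr add0r opprK addrC tlen_distC.
Qed.

(** Since [t = (x + t) - x], the weight [w t] is uniformly close to [w (x + t - z x)] with a
    finite-valued [z], to which [fubini_fin] applies. Each side then incurs an error [C * F * d]. *)
Lemma fubini_lip w f c l : bdd c -> bdd f -> bdd w -> tlen l ->
  (forall x y, `|w x - w y| <= l (x - y)) ->
  n (fun t => w t * m (fun x => c x * f (x + t))) = m (fun x => c x * smooth w f x).
Proof.
move=> bc bf bw hl wl; have [C C0 hC] := bdd_gt0 bc; have [F F0 hF] := bdd_gt0 bf.
have bs := smooth_bdd bw bf.
apply/eqP; rewrite -subr_eq0 -normr_le0; apply/ler_addgt0Pr => e e0; rewrite add0r.
have d0 : 0 < e / (2 * (C * F)) by rewrite divr_gt0// !mulr_gt0.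
have [K [z [uK zK hz]]] := tlen_net hl d0; set d := e / _ in d0 hz.
have de : C * F * d + C * F * d = e by rewrite /d; field; rewrite !gt_eqF.
pose H k y := f y * w (y - k).
have bH : bdd (fun p => H p.1 p.2) by rewrite /H.
have key := fubini_fin bc bH uK zK.
have bHz : bdd (fun p => H (z p.1) p.2) by exact: (bdd_comp2 (fun p => z p.1) snd).
have bHz' : bdd (fun p : G * G => H (z p.2) (p.2 + p.1)).
  exact: (bdd_comp2 (fun p => z p.2) (fun p => p.2 + p.1)).
have bHz'' t : bdd (fun x => H (z x) (x + t)).
  exact: (bdd_comp2 z (fun x => x + t)).
have bHx : bdd (fun x => m (H (z x))) by apply: bdd_st.
rewrite -de -(subrKA (m (fun x => c x * m (H (z x))))) (le_trans (ler_normD _ _))// lerD//.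
- rewrite -key -stB//; apply: st_bound => t; rewrite -stZ// -stB//; apply: st_bound => x.
  have -> : w t * (c x * f (x + t)) - c x * H (z x) (x + t) =
            c x * (f (x + t) * (w t - w (x + t - z x))) by rewrite /H; ring.
  rewrite normrM -mulrA ler_pM// normrM ler_pM// (le_trans (wl _ _))//.
  by rewrite opprB [x + t]addrC opprD addrCA addNKr -opprB (tlenN hl) hz.
- rewrite -stB//; apply: st_bound => x.
  rewrite -mulrBr normrM -mulrA ler_pM//.
  have : `|smooth w f (z x) - smooth w f x| <= F * l (z x - x) by exact: smooth_lip.
  by move=> /le_trans; apply; rewrite ler_pM2l// tlen_distC.
Qed.

End Fubini.
End AlmostPeriodic.

(** * Weak mixing *)

Section Orthonormal.
Variables (R : realType) (T : Type) (m : state R T).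

Definition orthonormal (k : nat) (e : nat -> T -> R) :=
  (forall i, bdd (e i)) /\
  forall i j, (i < k)%N -> (j < k)%N -> m (fun x => e i x * e j x) = (i == j)%:R.

Definition residue (k : nat) (e : nat -> T -> R) (d : T -> R) x :=
  d x - \sum_(i < k) m (fun y => d y * e i y) * e i x.

Variables (k : nat) (e : nat -> T -> R) (d : T -> R).
Hypotheses (oe : orthonormal k e) (bd : bdd d).

Let be i : bdd (e i). Proof. by case: oe. Qed.

Lemma residue_bdd : bdd (residue k e d).
Proof. by rewrite /residue. Qed.

Lemma residue_orth j : (j < k)%N -> m (fun x => residue k e d x * e j x) = 0.
Proof.
move=> jk; rewrite (_ : (fun x => _) = (fun x => d x * e j x -
   \sum_(i < k) m (fun y => d y * e i y) * (e i x * e j x))).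
  rewrite stB// st_sum//; under eq_bigr do rewrite stZ//.
  rewrite (bigD1 (Ordinal jk))//= oe.2// eqxx mulr1 big1 ?addr0 ?subrr//.
  by move=> i ij; rewrite oe.2// (negbTE (ij : (i : nat) != j)) mulr0.
apply: funext => x; rewrite /residue mulrBl mulr_suml; congr (_ - _).
by apply: eq_bigr => i _; rewrite mulrA.
Qed.

(** Pythagoras: the residue is orthogonal to the family, so one of its two factors may be replaced
    by [d]. *)
Lemma sqr_residue : m (fun x => residue k e d x ^+ 2) =
  m (fun x => d x ^+ 2) - \sum_(i < k) m (fun x => d x * e i x) ^+ 2.
Proof.
have br := residue_bdd.
transitivity (m (fun x => residue k e d x * d x)).
  rewrite (_ : (fun x => _ ^+ 2) = (fun x => residue k e d x * d x -
    \sum_(i < k) m (fun y => d y * e i y) * (residue k e d x * e i x))).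
    rewrite stB// st_sum//; under eq_bigr do rewrite stZ// residue_orth// mulr0.
    by rewrite big1_eq subr0.
  apply: funext => x; rewrite expr2 {2}/residue mulrBr mulr_sumr; congr (_ - _).
  by apply: eq_bigr => i _; rewrite mulrCA.
rewrite (_ : (fun x => _) = (fun x => d x ^+ 2 -
    \sum_(i < k) m (fun y => d y * e i y) * (d x * e i x))).
  by rewrite stB// st_sum//; under [in LHS]eq_bigr do rewrite stZ// -expr2.
apply: funext => x; rewrite /residue mulrBl mulr_suml expr2; congr (_ - _).
by apply: eq_bigr => i _; rewrite -mulrA [e i x * _]mulrC.
Qed.

Lemma bessel : \sum_(i < k) m (fun x => d x * e i x) ^+ 2 <= m (fun x => d x ^+ 2).
Proof. by rewrite -subr_ge0 -sqr_residue; apply: st_sqr_ge0; exact: residue_bdd. Qed.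

Lemma sqr_residue_le : m (fun x => residue k e d x ^+ 2) <= m (fun x => d x ^+ 2).
Proof. by rewrite sqr_residue gerBl; apply: sumr_ge0 => i _; exact: sqr_ge0. Qed.

End Orthonormal.

(** * Compactness of the correlation form *)

Section Compactness.
Variables (R : realType) (G : zmodType) (m n : state R G).
Hypotheses (im : invariant m) (inn : invariant n).
Variable u : G -> R.
Hypothesis u1 : forall x, `|u x| <= 1.

Let bu : bdd u. Proof. exact: bdd_by u1. Qed.

Definition corr (b : G -> R) h := m (fun x => u x * b (x + h)).
Definition qform b := n (fun h => corr b h ^+ 2).

Lemma corr_bdd b : bdd b -> bdd (corr b).
Proof. by move=> bb; rewrite /corr. Qed.

Lemma norm2_shift b h : bdd b -> norm2 m (fun x => b (x + h)) = norm2 m b.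
Proof. by move=> bb; rewrite /norm2 (@im (fun x => b x ^+ 2)). Qed.

Lemma norm_corr_le b h : bdd b -> `|corr b h| <= norm2 m b.
Proof.
move=> bb; rewrite /corr; apply: le_trans (norm2_CS _ _ _) _ => //.
rewrite norm2_shift// ler_piMl ?norm2_ge0//; exact: norm2_bound.
Qed.

Lemma qform_le b : bdd b -> qform b <= m (fun x => b x ^+ 2).
Proof.
move=> bb; have bc := corr_bdd bb; apply: le_trans (ler_norm _) _; apply: st_bound => h.
rewrite -sqr_norm2// normrX lerXn2r ?nnegrE ?norm2_ge0//.
exact: norm_corr_le.
Qed.

(* The form [qform] has trace at most 1, hence is compact. *)
Lemma qform_trace k e : orthonormal m k e -> \sum_(i < k) qform (e i) <= 1.
Proof.
move=> oe; have be i : bdd (e i) by case: oe.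
have bc i : bdd (corr (e i)) by exact: corr_bdd.
rewrite -st_sum// -(st_cst n 1); apply: st_le => // h.
have bs : bdd (fun x => u (x - h)) by [].
have := bessel oe bs; rewrite (_ : \sum_(i < k) _ = \sum_(i < k) corr (e i) h ^+ 2).
  move=> /le_trans; apply; apply: le_trans (ler_norm _) _; apply: st_bound => x.
  by rewrite normrX exprn_ile1.
apply: eq_bigr => i _; congr (_ ^+ 2).
rewrite -(@im (fun x => u (x - h) * e i x) h)//; congr (m _); apply: funext => x.
by rewrite addrK.
Qed.

(** A substitute for the spectral theorem: while the claim fails, a normalized counterexample
    extends the family by a vector with [qform] above [t], and more than [1 / t] such vectors break
    the trace bound. *)
Lemma exists_tail t : 0 < t -> exists k e, orthonormal m k e /\
  forall b, bdd b -> (forall i, (i < k)%N -> m (fun x => b x * e i x) = 0) ->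
    qform b <= t * m (fun x => b x ^+ 2).
Proof.
move=> t0; apply: contrapT => hn.
have step k : exists2 e, orthonormal m k e & forall i, (i < k)%N -> t < qform (e i).
  elim: k => [|k [e oe he]].
    by exists (fun _ _ => 0) => //; split=> // i.
  have [b [bb borth hb]] : exists b, [/\ bdd b,
      forall i, (i < k)%N -> m (fun x => b x * e i x) = 0 &
      t * m (fun x => b x ^+ 2) < qform b].
    apply: contrapT => hb; apply: hn; exists k, e; split=> // b bb borth.
    by rewrite leNgt; apply/negP => h; apply: hb; exists b.
  have mb0 : 0 < m (fun x => b x ^+ 2).
    rewrite lt_neqAle st_sqr_ge0// andbT eq_sym; apply/eqP => mb0.
    by have := qform_le bb; move: hb; rewrite mb0 mulr0; lra.
  have nb0 : 0 < norm2 m b by rewrite sqrtr_gt0.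
  set c := (norm2 m b)^-1; have be i : bdd (e i) by case: oe.
  have hc : c ^+ 2 * m (fun x => b x ^+ 2) = 1.
    by rewrite -sqr_norm2// -exprMn mulVf ?expr1n// gt_eqF.
  exists (fun i => if (i < k)%N then e i else (fun x => c * b x)).
    split=> [i|i j]; first by case: ifP.
    rewrite !ltnS (leq_eqVlt i) (leq_eqVlt j) => /predU1P[->|ik] /predU1P[->|jk].
    - rewrite ltnn eqxx -[RHS]hc -stZ//; congr (m _).
      by apply: funext => x; ring.
    - rewrite ltnn jk gtn_eqF// -[RHS](mulr0 c) -(borth j)// -stZ//; congr (m _).
      by apply: funext => x; ring.
    - rewrite ltnn ik ltn_eqF// -[RHS](mulr0 c) -(borth i)// -stZ//; congr (m _).
      by apply: funext => x; ring.
    - by rewrite ik jk oe.2.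
  move=> i; rewrite ltnS leq_eqVlt => /predU1P[->|ik]; last by rewrite ik he.
  rewrite ltnn; have -> : qform (fun x => c * b x) = c ^+ 2 * qform b.
    have bc := corr_bdd bb.
    rewrite /qform -stZ//; congr (n _); apply: funext => h; rewrite -exprMn; congr (_ ^+ 2).
    by rewrite /corr -stZ//; congr (m _); apply: funext => x; ring.
  have c2 : 0 < c ^+ 2 by rewrite exprn_gt0// invr_gt0.
  by rewrite -[t]mulr1 -hc mulrCA ltr_pM2l.
have [e oe he] := step (Num.truncn t^-1).+1.
have := qform_trace oe.
suff : 1 < \sum_(i < (Num.truncn t^-1).+1) qform (e i) by lra.
apply: (@lt_le_trans _ _ (\sum_(i < (Num.truncn t^-1).+1) t)).
  rewrite big_const_ord iter_addr addr0 -[ltRHS]mulr_natr -ltr_pdivrMl// mulr1.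
  exact: truncnS_gt.
by apply: ler_sum => i _; rewrite ltW// he.
Qed.

Variable f : G -> R.
Hypothesis f1 : forall x, `|f x| <= 1.

Let bf : bdd f. Proof. exact: bdd_by f1. Qed.
Let bU : bdd (corr f). Proof. exact: corr_bdd. Qed.

(** As [corr f (h + t)] is the correlation at [h] of the translate of [f] by [t], this is the
    distance from [f] to that translate in the seminorm [b |-> norm2 n (corr b)]. *)
Definition corr_len t := norm2 n (fun h => corr f (h + t) - corr f h).

Lemma corr_len_net e : 0 < e ->
  exists K : seq G, forall g, exists2 k, k \in K & corr_len (g - k) <= e.
Proof.
(* The difference [d] of two translates has mean square at most 4, so the tail contributes at most
   [e / 2]; the [k] coordinates, each within [e / 4 / (k + 1)], contribute at most [e / 4]. *)
move=> e0; have t0 : 0 < e ^+ 2 / 16 by rewrite divr_gt0// exprn_gt0.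
have [k [b [ob hb]]] := exists_tail t0.
have bb i : bdd (b i) by case: ob.
have nb (i : 'I_k) : norm2 m (b i) = 1.
  rewrite /norm2 (_ : (fun x => _) = (fun x => b i x * b i x)).
    by rewrite ob.2// eqxx sqrtr1.
  by apply: funext => x; rewrite expr2.
pose c (i : 'I_k) g := m (fun x => f (x + g) * b i x).
have k1 : 0 < k%:R + 1 :> R by rewrite ltr_wpDl.
have s0 : 0 < e / 4 / (k%:R + 1) by rewrite !divr_gt0.
have [i g|K hK] := @coord_net _ _ _ c _ s0.
  apply: le_trans (norm2_CS _ _ _) _ => //; rewrite nb mulr1.
  by apply: norm2_bound.
exists K => g; have [h hh close] := hK g; exists h => //.
pose d x := f (x + g) - f (x + h).
have bd : bdd d by rewrite /d.
pose r := residue m k b d.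
have br : bdd r by exact: residue_bdd.
have bc := corr_bdd br.
have rorth i : (i < k)%N -> m (fun x => r x * b i x) = 0 by exact: residue_orth.
have d2 : m (fun x => d x ^+ 2) <= 4.
  apply: le_trans (ler_norm _) _; apply: st_bound => x; rewrite normrX.
  rewrite (_ : 4 = 2 ^+ 2); last by rewrite -natrX.
  rewrite lerXn2r ?nnegrE// (le_trans (ler_normB _ _))//.
  by have := f1 (x + g); have := f1 (x + h); lra.
have qr : norm2 n (corr r) <= e / 2.
  rewrite -(@ler_pXn2r _ 2)// ?nnegrE ?norm2_ge0 ?divr_ge0 ?(ltW e0)// sqr_norm2//.
  apply: le_trans (hb r br rorth) _.
  have := sqr_residue_le ob bd; rewrite -/r => rd.
  have : e ^+ 2 / 16 * m (fun x => r x ^+ 2) <= e ^+ 2 / 16 * 4.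
    by rewrite ler_wpM2l ?(ltW t0)// (le_trans rd).
  by move=> /le_trans; apply; rewrite exprMn; lra.
pose D y := corr d y - corr r y.
have bD : bdd D by have := corr_bdd bd; rewrite /D.
have nD : norm2 n D <= e / 4.
  apply: norm2_bound; last by rewrite divr_ge0// ltW.
  move=> y; have -> : D y = \sum_(i < k) m (fun x => d x * b i x) * corr (b i) y.
    rewrite /D /corr -stB//; under eq_bigr do rewrite -stZ//.
    rewrite -st_sum//; congr (m _); apply: funext => x; rewrite -mulrBr /r /residue opprB.
    by rewrite addrC subrK mulr_sumr; apply: eq_bigr => i _; rewrite mulrCA.
  apply: le_trans (ler_norm_sum _ _ _) _.
  apply: (@le_trans _ _ (\sum_(i < k) (e / 4 / (k%:R + 1)))).
    apply: ler_sum => i _; rewrite normrM -[leRHS]mulr1 ler_pM//.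
      have := close i; rewrite /c -stB//; congr (`|m _| <= _).
      by apply: funext => x; rewrite /d mulrBl.
    by rewrite -(nb i) norm_corr_le.
  rewrite big_const_ord iter_addr addr0 -[leLHS]mulr_natr mulrAC ler_pdivrMr// mulrDr.
  by rewrite mulr1 lerDl divr_ge0// ltW.
have -> : corr_len (g - h) = norm2 n (fun y => D y + corr r y).
  rewrite /corr_len /norm2; congr Num.sqrt.
  rewrite -(@inn (fun y => (corr f (y + (g - h)) - corr f y) ^+ 2) h)//; congr (n _).
  apply: funext => y; congr (_ ^+ 2); rewrite /D subrK /corr /d -!stB//; congr (m _).
  apply: funext => x; rewrite mulrBr; congr (_ * f _ - _ * f _).
    by rewrite -!addrA [h + _]addrC subrK.
  by rewrite addrA.
by apply: le_trans (norm2D _ _ _) _ => //; lra.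
Qed.

Lemma tlen_corr_len : tlen corr_len.
Proof.
split.
- by move=> x; exact: norm2_ge0.
- move=> x; rewrite /corr_len /norm2; congr Num.sqrt.
  rewrite -(@inn (fun y => (corr f (y + - x) - corr f y) ^+ 2) x)//; congr (n _).
  by apply: funext => y; rewrite addrK -sqrrN opprB.
- move=> x y; rewrite /corr_len.
  have -> : norm2 n (fun h => corr f (h + x) - corr f h) =
            norm2 n (fun h => corr f (h + y + x) - corr f (h + y)).
    by rewrite /norm2 -(@inn (fun h => (corr f (h + x) - corr f h) ^+ 2) y).
  apply: le_trans (norm2D _ _ _) => //.
  rewrite le_eqVlt; apply/orP; left; apply/eqP; congr norm2; apply: funext => h.
  by rewrite subrKA addrAC addrA.
- exact: corr_len_net.
Qed.

End Compactness.

Section WeakMixing.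
Variables (R : realType) (G : zmodType) (m : state R G).
Hypotheses (im : invariant m) (em : ergodic m).

(** Orthogonality holds only up to [e], as an exact projection onto the almost periodic functions
    need not exist. *)
Definition ap_orth (e : R) (u : G -> R) := forall v, almost_periodic v ->
  (forall x, `|v x| <= 1) -> `|m (fun x => u x * v x)| <= e.

Variables (e : R) (u f : G -> R).
Hypotheses (u1 : forall x, `|u x| <= 1) (f1 : forall x, `|f x| <= 1) (ou : ap_orth e u).

Let bu : bdd u. Proof. exact: bdd_by u1. Qed.
Let bf : bdd f. Proof. exact: bdd_by f1. Qed.

(* [f] is close, in the seminorm [b |-> norm2 n (corr m u b)], to its average [v] over a small
   ball of [corr_len]; [v] is almost periodic, hence nearly orthogonal to [u]. The average is
   replaced by one over finitely many points because [n] and [m] need not commute. *)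
Lemma norm2_corr_le n : invariant n -> norm2 n (corr m u f) <= e.
Proof.
move=> inn; apply/ler_addgt0Pr => e' e'0.
have e1_0 : 0 < e' / 2 by rewrite divr_gt0.
set e1 := e' / 2 in e1_0.
have e1E : e1 + e1 = e' by rewrite /e1; field.
clearbody e1.
have bU : bdd (corr m u f) by exact: corr_bdd.
have hl := tlen_corr_len im inn u1 f1; set l := corr_len m n u f in hl.
(* A tent over the ball of radius [e1]; unlike the indicator it is Lipschitz for [l], as
   [fubini_lip] demands. *)
pose w x := Num.max 0 (e1 - l x).
have bl := tlen_bdd hl.
have bw : bdd w by rewrite /w.
have w0 x : 0 <= w x by rewrite le_max lexx.
have wl x y : `|w x - w y| <= l (x - y).
  have h1 : l x <= l (x - y) + l y by rewrite -{1}(subrK y x) (tlenD hl).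
  have h2 : l y <= l (x - y) + l x by rewrite (tlen_distC _ _ hl) -{1}(subrK x y) (tlenD hl).
  have h3 := tlen_ge0 hl (x - y).
  by rewrite ler_norml /w /Num.max; do 2 ?[case: ltP => ?]; lra.
have mw : 0 < m w.
  have [|K hK] := tlen_tb hl (e := e1 / 2); first by rewrite divr_gt0.
  have := @invariant_lower _ _ m w (e1 / 2) K im bw w0.
  have -> : (forall g, exists2 k, k \in K & e1 / 2 <= w (g - k)) = True.
    apply: propT => g; have [k kK hk] := hK g; exists k => //.
    by rewrite /w le_max; apply/orP; right; lra.
  move=> /(_ I) h; rewrite lt_neqAle st_ge0// andbT eq_sym; apply/eqP => mw0.
  by move: h; rewrite mw0; lra.
pose v x := (m w)^-1 * smooth m w f x.
have bs : bdd (smooth m w f) by exact: smooth_bdd.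
have bv : bdd v by rewrite /v.
have v1 x : `|v x| <= 1.
  rewrite /v normrM ger0_norm ?invr_ge0 ?(ltW mw)// ler_pdivrMl// mulr1.
  rewrite -(@im w (- x))//; apply: st_norm_le => // y.
  by rewrite normrM [ `|w _|]ger0_norm// ler_piMl.
have apv : almost_periodic v.
  apply: APZ; split => //; exists l => // x y.
  by rewrite -[leRHS]mul1r; apply: smooth_lip.
pose z t x := f (x + t) - v x.
have bz t : bdd (z t) by rewrite /z.
have z2 t : m (fun x => z t x ^+ 2) <= 4.
  apply: le_trans (ler_norm _) _; apply: st_bound => x; rewrite normrX.
  rewrite (_ : 4 = 2 ^+ 2); last by rewrite -natrX.
  rewrite lerXn2r ?nnegrE// (le_trans (ler_normB _ _))//.
  by have := f1 (x + t); have := v1 x; lra.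
(* [exists_small_sum] with [M = 4] and [c = 1] bounds the mean square of the sum by [6 * N], at most
   [(N * e1) ^ 2] for this [N]. *)
pose N := (Num.truncn (6 / e1 ^+ 2)).+1.
have N0 : 0 < N%:R :> R by rewrite ltr0n.
have hN : 6 <= N%:R * e1 ^+ 2.
  by rewrite -ler_pdivrMr ?exprn_gt0// ltW// truncnS_gt.
have [|//|s [ss sB sz]] := @exists_small_sum _ _ m _ z (fun t => 0 < w t) 4 1 N bz.
    by move=> t _.
  (* If every [t] of positive weight correlated by more than 1 with the sum [y], the [w]-weighted
     mean of these correlations would be at least [m w > 0]; but it is 0, since [v] is the weighted
     mean of the translates of [f]. *)
  move=> s _; apply: contrapT => hno.
  pose y x := \sum_(j <- s) z j x.
  have by' : bdd y by rewrite /y.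
  have gt1 t : w t <= w t * m (fun x => z t x * y x).
    have := w0 t; rewrite le_eqVlt => /predU1P[<-|wt]; first by rewrite mul0r.
    rewrite ler_pMr// leNgt; apply/negP => h; apply: hno; exists t => //.
    by rewrite ltW.
  have bzy : bdd (fun t => m (fun x => z t x * y x)) by rewrite /z.
  have : m w <= m (fun t => w t * m (fun x => z t x * y x)) by apply: st_le.
  rewrite (_ : (fun t => _) = (fun t => w t * m (fun x => y x * f (x + t)) -
     w t * m (fun x => y x * v x))).
    rewrite stB// stZr// (fubini_lip em im by' bf bw hl wl).
    rewrite (_ : (fun x => y x * v x) = (fun x => (m w)^-1 * (y x * smooth m w f x))).
      by rewrite stZ// mulVKf ?gt_eqF// subrr; lra.
    by apply: funext => x; rewrite /v mulrCA.
  apply: funext => t; rewrite -mulrBr -stB//; congr (_ * m _); apply: funext => x.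
  by rewrite /z; ring.
pose r x := \sum_(t <- s) z t x.
have br : bdd r by rewrite /r.
(* In correlations with [u], [N] copies of [f] split into displacements by points of the ball, the
   small sum [r], and [N] copies of [v]. *)
pose D h := \sum_(t <- s) (corr m u f h - corr m u f (h + t)).
have bD : bdd D by rewrite /D.
have br' := corr_bdd m u1 br; have bv' := corr_bdd m u1 bv.
have nD : norm2 n D <= N%:R * e1.
  rewrite -ss; apply: norm2_sum => // t ts.
  have := sB t ts; rewrite /w lt_max ltxx /= subr_gt0 => /ltW.
  rewrite /l /corr_len /norm2; congr (Num.sqrt (n _) <= _).
  by apply: funext => h; rewrite -sqrrN opprB.
have nr : norm2 n (corr m u r) <= N%:R * e1.
  apply: norm2_bound => [h|]; last by rewrite mulr_ge0// ltW.
  apply: le_trans (norm_corr_le im u1 _ br) _.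
  rewrite -(@ler_pXn2r _ 2)// ?nnegrE ?norm2_ge0//; last by rewrite mulr_ge0// ltW.
  rewrite sqr_norm2//; apply: le_trans sz _; rewrite exprMn expr2 -mulrA ler_pM2l//.
  by move: hN; lra.
have nv : norm2 n (corr m u v) <= e.
  apply: norm2_bound => [h|].
    by apply: ou => //; exact: AP_shift.
  by apply: le_trans (ou (AP_cst _ 0) _) => // x; rewrite normr0.
have : N%:R * norm2 n (corr m u f) <= N%:R * (e + e').
  rewrite -[N%:R in leLHS]ger0_norm ?(ltW N0)// -norm2Z//.
  rewrite (_ : (fun h => _) = (fun h => D h + (corr m u r h + N%:R * corr m u v h))).
    apply: le_trans (norm2D _ _ _) _ => //.
    rewrite (_ : N%:R * (e + e') = N%:R * e1 + (N%:R * e1 + N%:R * e)); last first.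
      by rewrite -e1E; ring.
    rewrite lerD//; apply: le_trans (norm2D _ _ _) _ => //.
    by rewrite lerD// norm2Z// ger0_norm ?(ltW N0)// ler_pM2l.
  apply: funext => h; rewrite /D sumrB big_const_seq iter_addr addr0 count_predT ss.
  rewrite -[corr m u f h *+ N]mulr_natl.
  rewrite (_ : \sum_(t <- s) _ = corr m u r h + N%:R * corr m u v h) ?subrK//.
  rewrite /corr -stZ// -stD// -st_sum//; congr (m _); apply: funext => x.
  rewrite /r; under eq_bigr do rewrite addrA [x + h + _]addrAC.
  rewrite /z -mulrCA -mulrDr sumrB big_const_seq iter_addr addr0 count_predT ss mulr_natl subrK.
  by rewrite mulr_sumr; apply: eq_bigr => t _; rewrite addrAC.
by rewrite ler_pM2l.
Qed.

End WeakMixing.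

(** * Homomorphisms with image of finite index *)

Section FiniteIndex.
Variables (R : realType) (G : zmodType).
Implicit Types (K : seq G) (H : set G) (phi psi : G -> G).

Definition translates_cover H K := forall g, exists2 k, k \in K & H (g - k).

Definition subgroup H := H 0 /\ forall x y, H x -> H y -> H (x - y).

Definition hom phi := {morph phi : x y / x + y}.

Lemma hom0 phi : hom phi -> phi 0 = 0.
Proof. by move=> hp; apply: (addrI (phi 0)); rewrite -hp !addr0. Qed.

Lemma homN phi x : hom phi -> phi (- x) = - phi x.
Proof. by move=> hp; apply: (addrI (phi x)); rewrite -hp !subrr hom0. Qed.

Lemma homB phi x y : hom phi -> phi (x - y) = phi x - phi y.
Proof. by move=> hp; rewrite hp homN. Qed.

Lemma subgroup_range phi : hom phi -> subgroup (range phi).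
Proof.
move=> hp; split; first by exists 0; rewrite ?hom0.
by move=> _ _ [x _ <-] [y _ <-]; exists (x - y); rewrite ?homB.
Qed.

Lemma cover_size_gt0 H K : translates_cover H K -> 0 < (size K)%:R :> R.
Proof. by move=> hK; have [k] := hK 0; case: K {hK} => //= k' K _ _; rewrite ltr0n. Qed.

(** [rho x] is the first element of [K] in the coset of [x], hence depends on the coset alone. *)
Lemma coset_rep H K : subgroup H -> translates_cover H K ->
  exists rho : G -> G, (forall x, rho x \in K) /\ forall x y, H (x - y) <-> rho x = rho y.
Proof.
move=> [H0 HB] hK.
have HN x : H x -> H (- x) by move=> hx; rewrite -[- x]add0r; exact: HB.
pose P x k := `[< H (x - k) >].
pose rho x := nth 0 K (find (P x) K).
have hasP x : has (P x) K.
  by have [k kK hk] := hK x; apply/hasP; exists k => //; apply/asboolP.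
have rhoK x : rho x \in K by rewrite mem_nth// -has_find.
have Hrho x : H (x - rho x) by apply/asboolP; exact: nth_find (hasP x).
exists rho; split=> // x y; split=> [Hxy|E].
  rewrite /rho; congr (nth _ _ _); apply: eq_find => k; apply/asboolP/asboolP => h.
    rewrite (_ : y - k = (x - k) - (x - y)); first exact: HB.
    by rewrite opprB [RHS]addrC subrKA.
  rewrite (_ : x - k = (y - k) - (- (x - y))); first by apply: HB => //; exact: HN.
  by rewrite opprK [RHS]addrC subrKA.
rewrite (_ : x - y = (x - rho x) - (y - rho y)); first exact: HB.
by rewrite E opprB subrKA.
Qed.

(** The witness is the length that vanishes on [H] and equals [2 * M] elsewhere. *)
Lemma AP_coset H K (v : G -> R) : subgroup H -> translates_cover H K -> bdd v ->
  (forall x y, H (x - y) -> v x = v y) -> almost_periodic v.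
Proof.
move=> [H0 HB] hK bv vH; split=> //; have [M M0 hM] := bdd_gt0 bv.
have HN x : H x -> H (- x) by move=> hx; rewrite -[- x]add0r; exact: HB.
have HD x y : H x -> H y -> H (x + y).
  by move=> hx hy; rewrite -[y]opprK; apply: HB => //; exact: HN.
pose l x : R := 2 * M * (~~ `[< H x >])%:R.
have M2 : 0 <= 2 * M by rewrite mulr_ge0// ltW.
have l0 x : H x -> l x = 0 by move=> hx; rewrite /l asboolT// mulr0.
have l1 x : ~ H x -> l x = 2 * M by move=> hx; rewrite /l asboolF// mulr1.
have lge0 x : 0 <= l x by rewrite /l mulr_ge0.
have lle x : l x <= 2 * M by rewrite /l; case: (~~ _); rewrite ?mulr1 ?mulr0.
exists l; last first.
  move=> x y; have [h|h] := pselect (H (x - y)).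
    by rewrite (vH x y)// subrr normr0.
  rewrite l1// (le_trans (ler_normB _ _))//.
  by have := hM x; have := hM y; lra.
split=> //.
- move=> x; have [h|h] := pselect (H x); first by rewrite !l0//; exact: HN.
  by rewrite !l1// => h'; apply: h; rewrite -[x]opprK; exact: HN.
- move=> x y; have [hx|hx] := pselect (H x); have [hy|hy] := pselect (H y).
  + by rewrite (l0 (x + y)) ?addr_ge0//; exact: HD.
  + by rewrite (l1 y)//; have := lge0 x; have := lle (x + y); lra.
  + by rewrite (l1 x)//; have := lge0 y; have := lle (x + y); lra.
  + by rewrite (l1 x)//; have := lge0 y; have := lle (x + y); lra.
- move=> e e0; exists K => g; have [k kK hk] := hK g; exists k => //.
  by rewrite l0// ltW.
Qed.

Definition range_ind phi y : R := (`[< range phi y >])%:R.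

Lemma range_ind_bdd phi : bdd (range_ind phi).
Proof. by rewrite /range_ind. Qed.

Section HomMean.
Variables (k n : state R G) (phi : G -> G) (K : seq G).
Hypotheses (ik : invariant k) (inn : invariant n) (hphi : hom phi).
Hypothesis hK : translates_cover (range phi) K.

(** The push-forward of [n] along [phi] is only known to be invariant under the range of [phi];
    convolving with [k] gives invariance under all of [G]. *)
Definition hom_mean : state R G := push_st (fun p : G * G => p.1 + phi p.2) (prod_st k n).

Lemma hom_mean_inv : invariant hom_mean.
Proof.
move=> f t bf /=; rewrite -[RHS](@ik _ t)//; congr (k _); apply: funext => y.
by congr (n _); apply: funext => h; rewrite addrAC.
Qed.

Lemma hom_mean_range (F : G -> R) : bdd F ->
  k (fun y => range_ind phi y * n (fun h => F (y + phi h))) = k (range_ind phi) * n (fun h => F (phi h)).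
Proof.
move=> bF; have bi := range_ind_bdd phi.
rewrite -stZr//; congr (k _); apply: funext => y; rewrite /range_ind.
case: asboolP => [[z _ <-]|]; last by rewrite !mul0r.
rewrite !mul1r -[RHS](@inn (fun h => F (phi h)) z)//; congr (n _); apply: funext => h.
by rewrite hphi addrC.
Qed.

Lemma ind_mean_ge : 1 <= (size K)%:R * k (range_ind phi).
Proof.
have bi := range_ind_bdd phi.
apply: invariant_lower => // g.
have [j jK hj] := hK g; exists j => //.
by rewrite /range_ind asboolT.
Qed.

(** Finite index gives the range of [phi] a [k]-mean of at least [1 / size K], and for shifts in the
    range the inner mean is that of [F] along [phi]. *)
Lemma hom_mean_ge (F : G -> R) : bdd F -> (forall x, 0 <= F x) ->
  n (fun h => F (phi h)) <= (size K)%:R * hom_mean F.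
Proof.
move=> bF F0; set A := n _; have bi := range_ind_bdd phi.
have A0 : 0 <= A by apply: st_ge0.
have : k (range_ind phi) * A <= hom_mean F.
  rewrite -hom_mean_range//; apply: st_le => // y /=.
  have : 0 <= n (fun h => F (y + phi h)) by apply: st_ge0.
  by rewrite /range_ind; case: asboolP => _; rewrite ?mul1r ?mul0r.
have : 1 * A <= (size K)%:R * k (range_ind phi) * A by rewrite ler_wpM2r// ind_mean_ge.
rewrite mul1r => h1 h2; apply: le_trans h1 _; rewrite -mulrA ler_wpM2l//.
Qed.

End HomMean.

Section CosetErgodic.
Variables (m n : state R G) (theta : G -> G) (K : seq G) (rho : G -> G).
Hypotheses (im : invariant m) (em : ergodic m) (inn : invariant n) (htheta : hom theta).
Hypotheses (uK : uniq K) (hK : translates_cover (range theta) K).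
Hypotheses (rhoK : forall x, rho x \in K).
Hypothesis rhoE : forall x y, range theta (x - y) <-> rho x = rho y.

Let ind k x : R := (rho x == k)%:R.
Let bi k : bdd (ind k). Proof. by rewrite /ind. Qed.

(** [m] need not be ergodic along [theta], but within one coset of the range it is, up to the mean
    of the range: in the ergodic identity for [hom_mean m n theta], only shifts in the range keep
    both points in coset [k]. *)
Lemma coset_ergodic k (B C : G -> R) : bdd B -> bdd C ->
  n (fun g => m (fun x => ind k x * B x * (ind k (x + theta g) * C (x + theta g)))) *
    m (range_ind theta) =
  m (fun x => ind k x * B x) * m (fun x => ind k x * C x).
Proof.
move=> bB bC.
pose F t := m (fun x => ind k x * B x * (ind k (x + t) * C (x + t))).
have bF : bdd F by rewrite /F.
have bii := range_ind_bdd theta.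
rewrite -(em (hom_mean_inv n theta im) (b := fun x => ind k x * B x) (f := fun x => ind k x * C x))//.
rewrite mulrC -(hom_mean_range m inn htheta bF); congr (m _); apply: funext => y.
rewrite /range_ind; case: asboolP => [_|hy]; first by rewrite mul1r.
rewrite mul0r -[LHS](st_cst n 0); congr (n _); apply: funext => g.
rewrite -[LHS](st_cst m 0); congr (m _); apply: funext => x /=.
rewrite /ind; case: (rho x =P k) => [E|]; last by rewrite !mul0r.
case: eqP => [E'|]; last by rewrite mul0r mulr0.
have /rhoE : rho (x + (y + theta g)) = rho x by rewrite E E'.
case=> z _ hz; exfalso; apply: hy; exists (z - g) => //.
by rewrite homB// hz [x + _]addrC !addrK.
Qed.

Lemma coset_ergodic_le (B C : G -> R) : bdd B -> (forall x, `|C x| <= 1) ->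
  `|n (fun g => m (fun x => B x * C (x + theta g)))| <=
  (size K)%:R * \sum_(k <- K) `|m (fun x => ind k x * B x)|.
Proof.
move=> bB C1; have bC : bdd C by exact: bdd_by C1.
pose A k := n (fun g => m (fun x => ind k x * B x * (ind k (x + theta g) * C (x + theta g)))).
have -> : n (fun g => m (fun x => B x * C (x + theta g))) = \sum_(k <- K) A k.
  rewrite -st_sum//; congr (n _); apply: funext => g; rewrite -st_sum//; congr (m _).
  apply: funext => x; rewrite (bigD1_seq (rho x))//= big1 => [|k /negbTE kx].
    have E : rho (x + theta g) = rho x.
      by apply/rhoE; exists g => //; rewrite addrAC subrr add0r.
    by rewrite /ind E !eqxx !mul1r addr0.
  by rewrite /ind eq_sym kx !mul0r.
rewrite mulr_sumr; apply: le_trans (ler_norm_sum _ _ _) _; apply: ler_sum => k _.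
have c1 := ind_mean_ge im hK; have e1 := coset_ergodic k bB bC.
set i := m (range_ind theta) in c1 e1.
have i0 : 0 <= i by apply: st_ge0 => [|x]; [exact: range_ind_bdd|rewrite /range_ind].
rewrite -[leLHS]mul1r; apply: (@le_trans _ _ ((size K)%:R * i * `|A k|)).
  by rewrite ler_wpM2r.
rewrite -mulrA ler_wpM2l// -[i in leLHS]ger0_norm// -normrM mulrC /A e1 normrM ler_piMr//.
apply: st_bound => x; rewrite normrM /ind.
by case: (rho x == k); rewrite ?normr1 ?normr0 ?mul1r ?mul0r.
Qed.

End CosetErgodic.
End FiniteIndex.

Lemma state_exists_le (R : realType) (T : Type) (n : state R T) (F : T -> R) c :
  bdd F -> n F < c -> exists x, F x <= c.
Proof.
move=> bF Fc; apply: contrapT => h; move: Fc; apply/negP; rewrite -leNgt.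
rewrite -[leLHS](st_cst n); apply: st_le => // x; rewrite leNgt; apply/negP => hx.
by apply: h; exists x; exact: ltW.
Qed.

(** * Van der Corput's inequality *)

Section VanDerCorput.
Variables (R : realType) (G : zmodType) (m : state R G).
Hypotheses (im : invariant m) (em : ergodic m).

Lemma ap_orth_mul e (b v : G -> R) : ap_orth m e b -> almost_periodic v ->
  (forall x, `|v x| <= 1) -> ap_orth m e (fun x => b x * v x).
Proof.
move=> ob av v1 w aw w1.
rewrite (_ : (fun x => _) = (fun x => b x * (v x * w x))); last first.
  by apply: funext => x; rewrite mulrA.
by apply: ob => [|x]; [exact: APM|rewrite normrM mulr_ile1].
Qed.

Lemma ap_orthW e e' (b : G -> R) : e <= e' -> ap_orth m e b -> ap_orth m e' b.
Proof. by move=> ee' ob v av v1; exact: le_trans (ob v av v1) ee'. Qed.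

Section TwoHoms.
Variables (phi psi : G -> G) (K1 K2 : seq G).
Hypotheses (hphi : hom phi) (hpsi : hom psi).
Hypothesis hK1 : translates_cover (range phi) K1.
Hypothesis hK2 : translates_cover (range (fun x => psi x - phi x)) K2.
Hypothesis uK2 : uniq K2.

Let theta x := psi x - phi x.

Let htheta : hom theta.
Proof. by move=> x y; rewrite /theta hphi hpsi opprD addrACA. Qed.

(** Up to the index, the mean along [phi] is dominated by an invariant mean, and [norm2_corr_le]
    holds for that one. *)
Lemma mean_corr_le n e (u f : G -> R) t : invariant n ->
  (forall x, `|u x| <= 1) -> (forall x, `|f x| <= 1) -> ap_orth m e u ->
  n (fun h => `|corr m u f (phi (h - t))|) <= (size K1)%:R * e.
Proof.
move=> inn u1 f1 ou.
have bu : bdd u by exact: bdd_by u1.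
have bf : bdd f by exact: bdd_by f1.
have bc : bdd (corr m u f) by exact: corr_bdd.
rewrite (@inn (fun h => `|corr m u f (phi h)|) (- t)); last first.
  by apply: bdd_norm; exact: (bdd_comp phi bc).
apply: le_trans (hom_mean_ge im inn hphi hK1 (F := fun y => `|corr m u f y|) _ _) _ => //.
rewrite ler_wpM2l//; have i2 := hom_mean_inv n phi im.
apply: le_trans (ler_norm _) _.
apply: le_trans (norm1_le_norm2 _ _) _ => //.
apply: le_trans (norm2_corr_le im em u1 f1 ou i2).
rewrite /norm2; set A := (X in Num.sqrt X <= _); set B := (X in _ <= Num.sqrt X).
suff -> : A = B by [].
by rewrite /A /B; congr st; apply: funext => x; rewrite real_normK ?num_real.
Qed.

(** Under [L], the functions [z h] are shifts in [g] of one product and have the same mean against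
    [a], so a small sum of [N] of them makes that mean small. Translating [x] turns their
    correlations into averages along [theta], where [coset_ergodic_le] leaves correlations of [b]
    with itself on cosets. *)
Lemma van_der_corput eta : 0 < eta -> exists2 e : R, 0 < e &
  forall b : G -> R, (forall x, `|b x| <= 1) -> ap_orth m e b ->
  forall n, invariant n -> forall a c : G -> R,
    (forall x, `|a x| <= 1) -> (forall x, `|c x| <= 1) ->
  `|n (fun g => m (fun x => a x * (b (x + phi g) * c (x + psi g))))| <= eta.
Proof.
move=> eta0.
(* With [M = 1] and [c = 1] the sum has mean square at most [3 * N <= (N * eta) ^ 2]. *)
pose N := (Num.truncn (3 / eta ^+ 2)).+1.
have N0 : 0 < N%:R :> R by rewrite ltr0n.
have hN : 3 <= N%:R * eta ^+ 2.
  by rewrite -ler_pdivrMr ?exprn_gt0// ltW// truncnS_gt.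
have k1 : 0 < (size K1)%:R :> R by exact: cover_size_gt0 hK1.
have k2 : 0 < (size K2)%:R :> R by exact: cover_size_gt0 hK2.
set s1 := (size K1)%:R in k1; set s2 := (size K2)%:R in k2.
have Q0 : 0 < 2 * (N%:R * s2 * s1) * s2 by rewrite !mulr_gt0.
(* The bound [F] on correlations has mean at most [N * s2 * s1 * e]. Some [h] stays within twice
   that, the 2 giving strictness, and [s2] times the result is then 1. *)
exists (2 * (N%:R * s2 * s1) * s2)^-1; first by rewrite invr_gt0.
set e := _^-1 => b b1 ob n inn a c a1 c1.
have e0 : 0 < e by rewrite /e invr_gt0.
have ba : bdd a by exact: bdd_by a1.
have bb : bdd b by exact: bdd_by b1.
have bc : bdd c by exact: bdd_by c1.
have [rho [rhoK rhoE]] := coset_rep (subgroup_range htheta) hK2.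
pose ind k x : R := (rho x == k)%:R.
have bi k : bdd (ind k) by rewrite /ind.
have ind1 k x : `|ind k x| <= 1 by rewrite /ind; case: eqP; rewrite ?normr1 ?normr0.
have api k t : almost_periodic (fun x => ind k (x + t)).
  apply: AP_shift; apply: AP_coset (subgroup_range htheta) hK2 (bi k) _ => x y /rhoE.
  by rewrite /ind => ->.
pose L := prod_st n m.
pose z h (p : G * G) := b (p.2 + phi (p.1 + h)) * c (p.2 + psi (p.1 + h)).
have bz h : bdd (z h) by rewrite /z.
have z1 h p : `|z h p| <= 1 by rewrite normrM mulr_ile1.
have Lz h j : `|L (fun p => z h p * z j p)| <=
   s2 * \sum_(k <- K2) `|corr m (fun x => b x * ind k (x - phi j)) b (phi (h - j))|.
  have -> : L (fun p => z h p * z j p) = n (fun g => m (fun x =>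
      b (x + phi h) * b (x + phi j) * (c (x + theta g + psi h) * c (x + theta g + psi j)))).
    congr (n _); apply: funext => g.
    rewrite -[RHS](@im _ (phi g))//; congr (m _); apply: funext => x; rewrite /z /=.
    have E : x + phi g + theta g = x + psi g by rewrite /theta -addrA subrKC.
    rewrite E !hphi !hpsi !addrA; ring.
  apply: le_trans (coset_ergodic_le im em inn htheta uK2 hK2 rhoK rhoE
    (B := fun x => b (x + phi h) * b (x + phi j))
    (C := fun x => c (x + psi h) * c (x + psi j)) _ _) _ => // [x|].
    by rewrite normrM mulr_ile1.
  rewrite ler_wpM2l ?(ltW k2)// le_eqVlt; apply/orP; left; apply/eqP; apply: eq_bigr => k _.
  congr (`| _ |); rewrite /corr -[RHS](@im _ (phi j))//; congr (m _); apply: funext => x.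
  by rewrite addrK homB// -addrA subrKC; ring.
have [|//|s [ss _ sz]] := @exists_small_sum _ _ L _ z (fun=> True) 1 1 N bz.
    move=> h _; apply: le_trans (ler_norm _) _; apply: st_bound => p.
    by rewrite normrX exprn_ile1.
  move=> s sN.
  pose F h := \sum_(j <- s) \sum_(k <- K2)
     `|corr m (fun x => b x * ind k (x - phi j)) b (phi (h - j))|.
  have bcorr j k : bdd (fun h => `|corr m (fun x => b x * ind k (x - phi j)) b (phi (h - j))|).
    have bc' : bdd (corr m (fun x => b x * ind k (x - phi j)) b) by rewrite /corr.
    by apply: bdd_norm; exact: (bdd_comp (fun h => phi (h - j)) bc').
  have bFj j : bdd (fun h => \sum_(k <- K2)
     `|corr m (fun x => b x * ind k (x - phi j)) b (phi (h - j))|) by exact: bdd_sum.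
  have bF : bdd F by exact: bdd_sum.
  have Fe : m F <= N%:R * s2 * s1 * e.
    rewrite st_sum//; apply: (@le_trans _ _ (\sum_(j <- s) (s2 * s1 * e))).
      apply: ler_sum => j _; rewrite st_sum//.
      apply: (@le_trans _ _ (\sum_(k <- K2) (s1 * e))).
        apply: ler_sum => k _; apply: mean_corr_le => // [x|].
          by rewrite normrM mulr_ile1.
        exact: ap_orth_mul.
      by rewrite big_const_seq iter_addr addr0 count_predT -[leLHS]mulr_natl mulrA.
    rewrite big_const_seq iter_addr addr0 count_predT -[leLHS]mulr_natl -!mulrA.
    by rewrite ler_wpM2r ?ler_nat ?(ltnW sN)// !mulr_ge0// ltW.
  have hQ : 2 * (N%:R * s2 * s1 * e) * s2 = 1.
    rewrite /e; field.
    by rewrite !gt_eqF.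
  have P0 : 0 < N%:R * s2 * s1 * e by rewrite !mulr_gt0.
  have [|h Fh] := @state_exists_le _ _ m F (2 * (N%:R * s2 * s1 * e)) bF.
    by apply: le_lt_trans Fe _; lra.
  exists h => //.
  rewrite (_ : (fun p => _) = (fun p => \sum_(j <- s) z h p * z j p)); last first.
    by apply: funext => p; rewrite mulr_sumr.
  rewrite st_sum//; apply: (@le_trans _ _ (s2 * F h)).
    by rewrite mulr_sumr; apply: ler_sum => j _; exact: le_trans (ler_norm _) (Lz h j).
  by rewrite -hQ mulrC ler_wpM2r// ltW.
pose A := n (fun g => m (fun x => a x * (b (x + phi g) * c (x + psi g)))).
rewrite -/A.
have LA h : L (fun p => a p.2 * z h p) = A.
  by rewrite /A -[RHS](@inn _ h).
have NA : N%:R * A = L (fun p => a p.2 * \sum_(j <- s) z j p).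
  rewrite (_ : (fun p => _) = (fun p => \sum_(j <- s) a p.2 * z j p)); last first.
    by apply: funext => p; rewrite mulr_sumr.
  rewrite st_sum//; under eq_bigr do rewrite LA.
  by rewrite big_const_seq iter_addr addr0 count_predT ss -[RHS]mulr_natl.
have bS : bdd (fun p => \sum_(j <- s) z j p) by exact: bdd_sum.
have ba2 : bdd (fun p : G * G => a p.2) by exact: (bdd_comp snd ba).
have := norm2_CS L ba2 bS; rewrite -NA normrM [ `|N%:R|]ger0_norm ?(ltW N0)// => h1.
have h2 : norm2 L (fun p : G * G => a p.2) <= 1 by exact: norm2_bound.
have h3 : norm2 L (fun p => \sum_(j <- s) z j p) <= N%:R * eta.
  rewrite -(@ler_pXn2r _ 2)// ?nnegrE ?norm2_ge0//; last by rewrite mulr_ge0// ltW.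
  rewrite sqr_norm2//; apply: le_trans sz _; rewrite exprMn expr2 -mulrA ler_pM2l//.
  by move: hN; lra.
rewrite -(ler_pM2l N0); apply: le_trans h1 _; apply: le_trans h3.
by rewrite ler_piMl ?norm2_ge0.
Qed.

End TwoHoms.
End VanDerCorput.

(** * Weighted triple averages *)

Section Weighted.
Variables (R : realType) (G : zmodType) (m : state R G).
Hypotheses (im : invariant m) (em : ergodic m).

Definition lip2 (l : G -> R) (Om : G -> G -> R) :=
  (forall s s' t, `|Om s t - Om s' t| <= l (s - s')) /\
  (forall s t t', `|Om s t - Om s t'| <= l (t - t')).

Definition triple (n : state R G) (Om : G -> G -> R) (phi psi : G -> G) (a b c : G -> R) :=
  n (fun g => Om (phi g) (psi g) * m (fun x => a x * (b (x + phi g) * c (x + psi g)))).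

(* With [y1 = x + phi g] and [y2 = x + psi g], the weight [Om (phi g) (psi g) =
   Om (y1 - x) (y2 - x)] is uniformly close to [Om (y1 - z x) (z y2 - z x)] for a finite-valued
   [z], and splits into finitely many products in which [b] is only multiplied by an almost
   periodic function. *)
Lemma weighted_van_der_corput (phi psi : G -> G) (K1 K2 : seq G) (l : G -> R)
    (Om : G -> G -> R) (eta : R) :
  hom phi -> hom psi -> translates_cover (range phi) K1 ->
  translates_cover (range (fun x => psi x - phi x)) K2 ->
  tlen l -> lip2 l Om -> (forall s t, `|Om s t| <= 1) -> 0 < eta ->
  exists2 e : R, 0 < e &
  forall b : G -> R, (forall x, `|b x| <= 1) -> ap_orth m e b ->
  forall n, invariant n -> forall a c : G -> R,
    (forall x, `|a x| <= 1) -> (forall x, `|c x| <= 1) ->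
  `|triple n Om phi psi a b c| <= eta.
Proof.
move=> hphi hpsi hK1 hK2 hl [Om1 Om2] OmB eta0.
have hK2' : translates_cover (range (fun x => psi x - phi x)) (undup K2).
  by move=> g; have [k kK hk] := hK2 g; exists k => //; rewrite mem_undup.
(* Replacing the weight costs [eta / 6] in the first argument and twice that in the second; the
   other [eta / 2] is shared by the [q * q] products. *)
have d0 : 0 < eta / 6 by rewrite divr_gt0.
have [K [z [uK zK hz]]] := tlen_net hl d0.
have K0 : 0 < (size K)%:R :> R by have := zK 0; case: (K) => //= k s _; rewrite ltr0n.
set q := (size K)%:R in K0.
have eta'0 : 0 < eta / 2 / (q * q) by rewrite !divr_gt0// mulr_gt0.
have [e e0 he] := van_der_corput im em hphi hpsi hK1 hK2' (undup_uniq _) eta'0.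
exists e => // b b1 ob n inn a c a1 c1.
have ba : bdd a by exact: bdd_by a1.
have bb : bdd b by exact: bdd_by b1.
have bc : bdd c by exact: bdd_by c1.
have bOm : bdd (fun p => Om p.1 p.2) by exists 1 => p.
have bOmz : bdd (fun p : G * G => Om (p.2 + phi p.1 - z p.2) (z (p.2 + psi p.1) - z p.2)).
  by exists 1 => p.
have bOmz' g : bdd (fun x => Om (x + phi g - z x) (z (x + psi g) - z x)).
  by exists 1 => p.
pose J := n (fun g => m (fun x => a x * (b (x + phi g) * c (x + psi g)) *
   Om (x + phi g - z x) (z (x + psi g) - z x))).
rewrite -[triple _ _ _ _ _ _ _](subrK J) (splitr eta) (le_trans (ler_normD _ _))// lerD//.
  rewrite /triple -stB//; apply: st_bound => g; rewrite -stZ// -stB//; apply: st_bound => x.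
  have -> : forall A u v : R, u * A - A * v = A * (u - v) by move=> *; ring.
  rewrite normrM; apply: (@le_trans _ _ (1 * (eta / 2))); last by rewrite mul1r.
  rewrite ler_pM//; first by rewrite !normrM !mulr_ile1// mulr_ge0.
  set p := Om _ _; set r := Om _ _.
  have h1 : `|p - Om (x + phi g - z x) (psi g)| <= eta / 6.
    apply: le_trans (Om1 _ _ _) _.
    by rewrite opprB [x + phi g]addrC opprD addrCA addNKr -opprB (tlenN hl) hz.
  have h2 : `|Om (x + phi g - z x) (psi g) - r| <= eta / 6 + eta / 6.
    apply: le_trans (Om2 _ _ _) _.
    have -> : psi g - (z (x + psi g) - z x) = (x + psi g - z (x + psi g)) - (x - z x).
      by rewrite !opprB [x + psi g]addrC -!addrA; congr (_ + _); rewrite [RHS]addrCA [x + (_ - _)]addrC subrK; exact: addrC.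
    by apply: le_trans (tlenD hl _ _) _; rewrite (tlenN hl) lerD.
  rewrite -[p - r](subrKA (Om (x + phi g - z x) (psi g))).
  by apply: le_trans (ler_normD _ _) _; move: h1 h2; lra.
have sel (F : G -> R) y : F (z y) = \sum_(k <- K) (z y == k)%:R * F k.
  rewrite (bigD1_seq (z y))//= eqxx mul1r big1 ?addr0// => k kz.
  by rewrite eq_sym (negbTE kz) mul0r.
have -> : J = \sum_(k <- K) \sum_(k' <- K) n (fun g => m (fun x => a x * (z x == k)%:R *
   (b (x + phi g) * Om (x + phi g - k) (k' - k) * (c (x + psi g) * (z (x + psi g) == k')%:R)))).
  rewrite /J; under eq_bigr do rewrite -st_sum//.
  rewrite -st_sum//; congr (n _); apply: funext => g.
  under eq_bigr do rewrite -st_sum//.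
  rewrite -st_sum//; congr (m _); apply: funext => x.
  rewrite (sel (fun k => Om (x + phi g - k) (z (x + psi g) - k))) mulr_sumr.
  apply: eq_bigr => k _; rewrite (sel (fun k' => Om (x + phi g - k) (k' - k))).
  by rewrite !mulr_sumr; apply: eq_bigr => k' _; ring.
apply: le_trans (ler_norm_sum _ _ _) _.
apply: (@le_trans _ _ (\sum_(k <- K) \sum_(k' <- K) (eta / 2 / (q * q)))); last first.
  have cst (r : R) : \sum_(k <- K) r = q * r.
    by rewrite big_const_seq iter_addr addr0 count_predT -[LHS]mulr_natl.
  by rewrite !cst mulrA mulrC divfK// gt_eqF// mulr_gt0.
apply: ler_sum => k _; apply: le_trans (ler_norm_sum _ _ _) _; apply: ler_sum => k' _.
apply: (he (fun y => b y * Om (y - k) (k' - k)) _ _ n inn (fun x => a x * (z x == k)%:R)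
   (fun y => c y * (z y == k')%:R)).
- by move=> x; rewrite normrM mulr_ile1.
- apply: ap_orth_mul => //; split; first by exists 1.
  exists l => // x y; apply: le_trans (Om1 _ _ _) _.
  by rewrite opprB addrA subrK.
- by move=> x; rewrite normrM mulr_ile1//; case: (_ == _); rewrite ?normr1 ?normr0.
- by move=> x; rewrite normrM mulr_ile1//; case: (_ == _); rewrite ?normr1 ?normr0.
Qed.

(** Van der Corput controls the middle function. Exchanging [phi] and [psi] reaches the last one;
    translating [x] by [- phi g] reaches the first, with [- phi] and [psi - phi] as the new pair and
    [psi] as its difference. *)
Lemma triple_small (phi psi : G -> G) (K1 K2 K3 : seq G) (l : G -> R)
    (Om : G -> G -> R) (eta : R) :
  hom phi -> hom psi -> translates_cover (range phi) K1 -> translates_cover (range psi) K2 ->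
  translates_cover (range (fun x => phi x - psi x)) K3 ->
  tlen l -> lip2 l Om -> (forall s t, `|Om s t| <= 1) -> 0 < eta ->
  exists2 e : R, 0 < e &
  forall u : G -> R, (forall x, `|u x| <= 1) -> ap_orth m e u ->
  forall n, invariant n -> forall a c : G -> R,
    (forall x, `|a x| <= 1) -> (forall x, `|c x| <= 1) ->
  [/\ `|triple n Om phi psi u a c| <= eta, `|triple n Om phi psi a u c| <= eta &
      `|triple n Om phi psi a c u| <= eta].
Proof.
move=> hphi hpsi hK1 hK2 hK3 hl [Om1 Om2] OmB eta0.
have hK3' : translates_cover (range (fun x => psi x - phi x)) K3.
  move=> g; have [k kK [y _ hy]] := hK3 g; exists k => //; exists (- y) => //.
  by rewrite (homN _ hpsi) (homN _ hphi) opprK addrC hy.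
have hK1N : translates_cover (range (fun x => - phi x)) K1.
  move=> g; have [k kK [y _ hy]] := hK1 g; exists k => //; exists (- y) => //.
  by rewrite homN// opprK.
have hphiN : hom (fun x => - phi x) by move=> x y; rewrite hphi opprD.
have htheta : hom (fun x => psi x - phi x) by move=> x y; rewrite hphi hpsi opprD addrACA.
have hK2' : translates_cover (range (fun x => psi x - phi x - - phi x)) K2.
  rewrite (_ : (fun x => _) = psi)//; by apply: funext => x; rewrite opprK subrK.
have [e2 e20 he2] := weighted_van_der_corput hphi hpsi hK1 hK3' hl (conj Om1 Om2) OmB eta0.
have [|//|e3 e30 he3] := weighted_van_der_corput (Om := fun s t => Om t s)
   hpsi hphi hK2 hK3 hl _ _ eta0; first by split => *; [exact: Om2|exact: Om1].
have [|//|e1 e10 he1] := weighted_van_der_corput (Om := fun s t => Om (- s) (t - s))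
   hphiN htheta hK1N hK2' (tlen_add hl hl) _ _ eta0.
  split=> [s s' t|s t t'].
    rewrite -(subrKA (Om (- s') (t - s))) (le_trans (ler_normD _ _))// lerD//.
      by apply: le_trans (Om1 _ _ _) _; rewrite -opprD (tlenN hl).
    apply: le_trans (Om2 _ _ _) _.
    by rewrite opprB addrC subrKA (tlen_distC _ _ hl).
  apply: le_trans (Om2 _ _ _) _; rewrite opprB addrA subrK.
  by rewrite lerDl (tlen_ge0 hl).
exists (Num.min e1 (Num.min e2 e3)); first by rewrite !lt_min e10 e20.
move=> u u1 ou n inn a c a1 c1.
have ou1 : ap_orth m e1 u by apply: ap_orthW ou; rewrite ge_min lexx.
have ou2 : ap_orth m e2 u by apply: ap_orthW ou; rewrite !ge_min lexx orbT.
have ou3 : ap_orth m e3 u by apply: ap_orthW ou; rewrite !ge_min lexx !orbT.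
have ba : bdd a by exact: bdd_by a1.
have bu : bdd u by exact: bdd_by u1.
have bc : bdd c by exact: bdd_by c1.
split; last 2 first.
- exact: he2.
- have := he3 u u1 ou3 n inn a c a1 c1; congr (`|_| <= _); congr (n _).
  apply: funext => g; congr (_ * m _); apply: funext => x; by rewrite [c _ * _]mulrC.
have := he1 u u1 ou1 n inn a c a1 c1; congr (`|_| <= _); congr (n _); apply: funext => g.
rewrite !opprK subrK; congr (_ * _).
rewrite -[RHS](@im _ (- phi g))//; congr (m _); apply: funext => x.
by rewrite subrK mulrCA; congr (_ * (_ * c _)); rewrite addrA addrAC.
Qed.

End Weighted.

(** * The lower bound for an ergodic mean *)

Section Approximation.
Variables (R : realType) (G : zmodType) (m : state R G) (f : G -> R).
Hypothesis f01 : forall x, 0 <= f x <= 1.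

Let bf : bdd f.
Proof. by exists 1 => x; have /andP[h0 h1] := f01 x; rewrite ger0_norm. Qed.

Definition ap_dist := inf [set m (fun x => (f x - a x) ^+ 2) | a in almost_periodic (R := R) (G := G)].

Lemma ap_dist_le a : almost_periodic a -> ap_dist <= m (fun x => (f x - a x) ^+ 2).
Proof.
move=> aa; apply: ge_inf; last by exists a.
by exists 0 => _ [b [bb _] <-]; apply: st_sqr_ge0.
Qed.

(** A near-minimizer is nearly orthogonal: passing from [a'] to [a' + e * v] can lower the squared
    distance by at most [e ^ 2], which bounds the inner product by [e]. Clamping to [[0, 1]] moves
    [a] no farther from [f]. *)
Lemma exists_ap_approx e : 0 < e -> exists a, [/\ almost_periodic a, forall x, 0 <= a x <= 1,
  m (fun x => (f x - a x) ^+ 2) <= ap_dist + e ^+ 2 & ap_orth m e (fun x => f x - a x)].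
Proof.
move=> e0; have e20 : 0 < e ^+ 2 by rewrite exprn_gt0.
have [|_ [a aa <-] ha] := @inf_adherent _ [set m (fun x => (f x - a x) ^+ 2) | a in almost_periodic (R := R) (G := G)] _ e20.
  split; first by exists (m (fun x => (f x - 0) ^+ 2)); exists (fun=> 0) => //; exact: AP_cst.
  by exists 0 => _ [b [bb _] <-]; apply: st_sqr_ge0.
pose a' x := Num.max 0 (Num.min 1 (a x)).
have aa' : almost_periodic a' by exact: AP_clamp.
have ba : bdd a by case: aa.
have ba' : bdd a' by case: aa'.
have ha' : m (fun x => (f x - a' x) ^+ 2) <= ap_dist + e ^+ 2.
  apply: le_trans (ltW ha); apply: st_le => // x.
  have fx : f x = Num.max 0 (Num.min 1 (f x)).
    by have /andP[h0 h1] := f01 x; rewrite (min_idPr h1) (max_idPr h0).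
  rewrite -[leLHS]real_normK ?num_real// -[leRHS]real_normK ?num_real//.
  by rewrite lerXn2r ?nnegrE// {1}fx clamp_lip.
exists a'; split=> //.
  by move=> x; rewrite /a' le_max lexx /= ge_max ler01 ge_min lexx.
have orth1 v : almost_periodic v -> (forall x, `|v x| <= 1) -> m (fun x => (f x - a' x) * v x) <= e.
  move=> av v1; have bv : bdd v by case: av.
  have := ap_dist_le (APD aa' (APZ e av)).
  rewrite (_ : (fun x => _) = (fun x => (f x - a' x) ^+ 2 +
    (e ^+ 2 * v x ^+ 2 - 2 * e * ((f x - a' x) * v x)))); last by apply: funext => x; ring.
  rewrite stD// stB// !stZ// => h.
  have v2 : m (fun x => v x ^+ 2) <= 1.
    by apply: le_trans (ler_norm _) _; apply: st_bound => x; rewrite normrX exprn_ile1.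
  have : e ^+ 2 * m (fun x => v x ^+ 2) <= e ^+ 2 by rewrite ler_piMr// ltW.
  move=> h2; have : 2 * e * m (fun x => (f x - a' x) * v x) <= 2 * e * e.
    by move: h ha' h2; rewrite expr2; lra.
  by rewrite ler_pM2l// mulr_gt0.
move=> v av v1; have bv : bdd v by case: av.
rewrite ler_norml orth1// andbT lerNl -stN//.
have := @orth1 (fun x => -1 * v x) (APZ _ av).
rewrite (_ : (fun x => (f x - a' x) * (-1 * v x)) = (fun x => - ((f x - a' x) * v x))).
  by apply => x; rewrite mulN1r normrN.
by apply: funext => x; ring.
Qed.

End Approximation.

Section TripleTheory.
Variables (R : realType) (G : zmodType) (m n : state R G).
Variables (Om : G -> G -> R) (phi psi : G -> G).
Hypotheses (im : invariant m) (bOm : bdd (fun p => Om p.1 p.2)).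
Implicit Types a b c s : G -> R.

Local Notation T := (triple m n Om phi psi).

Lemma triple_add1 a a' b c : bdd a -> bdd a' -> bdd b -> bdd c ->
  T (fun x => a x + a' x) b c = T a b c + T a' b c.
Proof.
move=> ba ba' bb bc; rewrite /triple -stD//; congr (n _); apply: funext => g.
by rewrite -mulrDr -stD//; congr (_ * m _); apply: funext => x; ring.
Qed.

Lemma triple_add2 a b b' c : bdd a -> bdd b -> bdd b' -> bdd c ->
  T a (fun x => b x + b' x) c = T a b c + T a b' c.
Proof.
move=> ba bb bb' bc; rewrite /triple -stD//; congr (n _); apply: funext => g.
by rewrite -mulrDr -stD//; congr (_ * m _); apply: funext => x; ring.
Qed.

Lemma triple_add3 a b c c' : bdd a -> bdd b -> bdd c -> bdd c' ->
  T a b (fun x => c x + c' x) = T a b c + T a b c'.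
Proof.
move=> ba bb bc bc'; rewrite /triple -stD//; congr (n _); apply: funext => g.
by rewrite -mulrDr -stD//; congr (_ * m _); apply: funext => x; ring.
Qed.

Hypothesis Om0 : forall x y, 0 <= Om x y.
Let W g := Om (phi g) (psi g).

Lemma triple_norm1_le s a c : bdd s -> (forall x, `|a x| <= 1) -> (forall x, `|c x| <= 1) ->
  [/\ `|T s a c| <= n W * m (fun x => `|s x|), `|T a s c| <= n W * m (fun x => `|s x|) &
      `|T a c s| <= n W * m (fun x => `|s x|)].
Proof.
move=> bs a1 c1.
have ba : bdd a by exact: bdd_by a1.
have bc : bdd c by exact: bdd_by c1.
have bW : bdd W by exact: (bdd_comp2 phi psi bOm).
have key (F : G -> G -> R) (h : G -> G) : bdd (fun p => F p.1 p.2) ->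
   (forall g x, `|F g x| <= `|s (x + h g)|) ->
   `|n (fun g => W g * m (F g))| <= n W * m (fun x => `|s x|).
  move=> bF hF; have bFg g : bdd (F g) by exact: (bdd_comp2 (fun=> g) id bF).
  have bmF : bdd (fun g => m (F g)) by exact: bdd_st.
  rewrite -stZr//; apply: st_norm_le => // g.
  rewrite normrM ger0_norm ?Om0// ler_wpM2l ?Om0//.
  by rewrite -(@im (fun x => `|s x|) (h g))//; apply: st_norm_le.
split.
- apply: (key (fun g x => s x * (a (x + phi g) * c (x + psi g))) (fun=> 0)) => // g x.
  by rewrite addr0 normrM ler_piMr// normrM mulr_ile1.
- apply: (key (fun g x => a x * (s (x + phi g) * c (x + psi g))) phi) => // g x.
  by rewrite mulrCA normrM ler_piMr// normrM mulr_ile1.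
- apply: (key (fun g x => a x * (c (x + phi g) * s (x + psi g))) psi) => // g x.
  by rewrite mulrA mulrC normrM ler_piMr// normrM mulr_ile1.
Qed.

End TripleTheory.

Section Khintchine.
Variables (R : realType) (G : zmodType) (m : state R G).
Hypotheses (im : invariant m) (em : ergodic m).
Variables (phi psi : G -> G) (K1 K2 K3 : seq G).
Hypotheses (hphi : hom phi) (hpsi : hom psi).
Hypotheses (hK1 : translates_cover (range phi) K1) (hK2 : translates_cover (range psi) K2).
Hypothesis hK3 : translates_cover (range (fun x => phi x - psi x)) K3.
Variable f : G -> R.
Hypothesis f01 : forall x, 0 <= f x <= 1.

(** Jensen's inequality through the tangent at [t = m a], which the cube exceeds by
    [(a - t) ^ 2 * (a + 2 * t)]. *)
Lemma cube_mean_le (a : G -> R) : (forall x, 0 <= a x <= 1) -> m a ^+ 3 <= m (fun x => a x ^+ 3).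
Proof.
move=> a01; have ba : bdd a by exists 1 => x; have /andP[h0 h1] := a01 x; rewrite ger0_norm.
have t0 : 0 <= m a by apply: st_ge0 => // x; case/andP: (a01 x).
set t := m a in t0 *.
have -> : t ^+ 3 = m (fun x => 3 * t ^+ 2 * a x - 2 * t ^+ 3).
  by rewrite stB// stZ// st_cst -/t; ring.
apply: st_le => // x; rewrite -subr_ge0.
have -> : a x ^+ 3 - (3 * t ^+ 2 * a x - 2 * t ^+ 3) = (a x - t) ^+ 2 * (a x + 2 * t) by ring.
by rewrite mulr_ge0 ?sqr_ge0// addr_ge0 ?mulr_ge0//; case/andP: (a01 x).
Qed.

(* Two approximations of [f] are needed: [a0] fixes the weight, and [a1] is then chosen so
   accurate, depending on the weight, that [f - a1] is negligible; [a1 - a0] is small in norm. *)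
Lemma khintchine_mean (n : state R G) (S : set G) (eps : R) : invariant n -> 0 < eps ->
  n (fun g => (`[< S g >])%:R) = 0 ->
  exists2 g, ~ S g & m f ^+ 3 - eps < m (fun x => f x * (f (x + phi g) * f (x + psi g))).
Proof.
move=> inn eps0 nS; apply: contrapT => hno.
pose M g := m (fun x => f x * (f (x + phi g) * f (x + psi g))).
have hM g : ~ S g -> M g <= m f ^+ 3 - eps.
  by move=> Sg; rewrite leNgt; apply/negP => h; apply: hno; exists g.
have f1 x : `|f x| <= 1 by have /andP[h0 h1] := f01 x; rewrite ger0_norm.
have bf : bdd f by exact: bdd_by f1.
have d0 : 0 <= m f by apply: st_ge0 => // x; case/andP: (f01 x).
have d1 : m f <= 1 by rewrite -(st1 m); apply: st_le => // x; case/andP: (f01 x).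
(* In units of [n W], the losses below are [3 * e0] from [u], [6 * e0] from [s], [2 * e0] in [E3]
   and [3 * e0] in [E4]: in total [14 * e0 < eps]. *)
pose e0 := Num.min 1 (eps / 15).
have e0p : 0 < e0 by rewrite lt_min ltr01 divr_gt0.
have e01 : e0 <= 1 by rewrite ge_min lexx.
have e0eps : 15 * e0 <= eps.
  by rewrite mulrC -ler_pdivlMr// ge_min lexx orbT.
have [a0 [[ba0 [l hl a0l]] a001 a0d a0o]] := exists_ap_approx m f01 e0p.
have apa0 : almost_periodic a0 by split=> //; exists l.
have a01 x : `|a0 x| <= 1 by have /andP[h0 h1] := a001 x; rewrite ger0_norm.
have bl := tlen_bdd hl; have l0 := tlen_ge0 hl.
pose Om s t := Num.max 0 (e0 - l s - l t).
have Om0 s t : 0 <= Om s t by rewrite le_max lexx.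
have OmE s t : Om s t <= e0.
  by rewrite /Om /Num.max; case: ltP => _; [have := l0 s; have := l0 t; lra|exact: ltW].
have Om1 s t : `|Om s t| <= 1 by rewrite ger0_norm// (le_trans (OmE s t)).
have ld x y : l x - l y <= l (x - y) by rewrite lerBlDr -{1}(subrK y x) (tlenD hl).
have hOm : lip2 l Om.
  split=> [s s' t|s t t'].
    have := ld s s'; have := ld s' s; rewrite (tlen_distC s' s hl) => h1 h2; have h3 := l0 (s - s').
    by rewrite ler_norml /Om /Num.max; do 2 ?[case: ltP => ?]; lra.
  have := ld t t'; have := ld t' t; rewrite (tlen_distC t' t hl) => h1 h2; have h3 := l0 (t - t').
  by rewrite ler_norml /Om /Num.max; do 2 ?[case: ltP => ?]; lra.
have bOm : bdd (fun p => Om p.1 p.2) by exists 1 => p.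
pose W g := Om (phi g) (psi g).
have bW : bdd W by exact: (bdd_comp2 phi psi bOm).
have nW0 : 0 < n W.
  have [|K hK] := tlen_net_pair phi psi hl hl (e := e0 / 4); first by rewrite divr_gt0.
  have h : e0 / 2 <= (size K)%:R * n W.
    apply: invariant_lower => // [x|g]; first exact: Om0.
    have [k kK [h1 h2]] := hK g; exists k => //.
    by rewrite /W /Om (homB _ _ hphi) (homB _ _ hpsi) le_max; apply/orP; right; lra.
  rewrite lt_neqAle (_ : 0 <= n W) ?andbT; last by apply: st_ge0 => // x; exact: Om0.
  rewrite eq_sym; apply/eqP => nW0.
  by move: h; rewrite nW0 mulr0; lra.
have eta0 : 0 < e0 * n W by rewrite mulr_gt0.
have [e ep he] := triple_small im em hphi hpsi hK1 hK2 hK3 hl hOm Om1 eta0.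
(* The bound [e0 ^ 2 / 2] absorbs the cross term [2 * m (u * s)]; since [a0] nearly minimizes the
   distance to [f], this gives [m (s ^ 2) <= 2 * e0 ^ 2]. *)
pose e1 := Num.min e (e0 ^+ 2 / 2).
have e1p : 0 < e1 by rewrite lt_min ep divr_gt0// exprn_gt0.
have e1e : e1 <= e by rewrite ge_min lexx.
have e1e0 : 2 * e1 <= e0 ^+ 2.
  by rewrite mulrC -ler_pdivlMr// ge_min lexx orbT.
have [a1 [apa1 a101 a1d a1o]] := exists_ap_approx m f01 e1p.
have a11 x : `|a1 x| <= 1 by have /andP[h0 h1] := a101 x; rewrite ger0_norm.
have ba1 : bdd a1 by exact: bdd_by a11.
pose u x := f x - a1 x; pose s x := a1 x - a0 x.
have bu : bdd u by rewrite /u.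
have bs : bdd s by rewrite /s.
have u1 x : `|u x| <= 1.
  by have := f01 x; have := a101 x; rewrite /u ler_norml; lra.
have s1 x : `|s x| <= 1.
  by have := a001 x; have := a101 x; rewrite /s ler_norml; lra.
have aps : almost_periodic s.
  rewrite /s (_ : (fun x => _) = (fun x => a1 x + -1 * a0 x)); last first.
    by apply: funext => x; rewrite mulN1r.
  by apply: APD => //; exact: APZ.
have ms : m (fun x => `|s x|) <= 2 * e0.
  have s2 : m (fun x => s x ^+ 2) <= 2 * e0 ^+ 2.
    have := ap_dist_le m f01 apa1; have := a1o s aps s1; move: a0d.
    rewrite (_ : (fun x => (f x - a0 x) ^+ 2) = (fun x => (f x - a1 x) ^+ 2 +
      (2 * ((f x - a1 x) * s x) + s x ^+ 2))); last by apply: funext => x; rewrite /s; ring.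
    rewrite !stD// stZ// ler_norml => h1 /andP[h2 h3] h4; lra.
  apply: le_trans (ler_norm _) _; apply: le_trans (norm1_le_norm2 _ _) _ => //.
  rewrite -(@ler_pXn2r _ 2)// ?nnegrE ?norm2_ge0//; last by rewrite mulr_ge0// ltW.
  rewrite sqr_norm2//; under eq_fun do rewrite real_normK ?num_real//.
  by apply: le_trans s2 _; rewrite exprMn; have := sqr_ge0 e0; lra.
have [t1 _ _] := he u u1 (ap_orthW e1e a1o) n inn f f f1 f1.
have [_ t2 _] := he u u1 (ap_orthW e1e a1o) n inn a1 f a11 f1.
have [_ _ t3] := he u u1 (ap_orthW e1e a1o) n inn a1 a1 a11 a11.
have [s1' _ _] := triple_norm1_le n phi psi im bOm Om0 bs a11 a11.
have [_ s2' _] := triple_norm1_le n phi psi im bOm Om0 bs a01 a11.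
have [_ _ s3'] := triple_norm1_le n phi psi im bOm Om0 bs a01 a01.
have nWs : n W * m (fun x => `|s x|) <= n W * (2 * e0) by rewrite ler_pM2l.
have fE : f = (fun x => u x + a1 x) by apply: funext => x; rewrite /u subrK.
have a1E : a1 = (fun x => s x + a0 x) by apply: funext => x; rewrite /s subrK.
have E1 : triple m n Om phi psi f f f = triple m n Om phi psi u f f +
   (triple m n Om phi psi a1 u f + (triple m n Om phi psi a1 a1 u + triple m n Om phi psi a1 a1 a1)).
  rewrite -triple_add3// -fE -triple_add2// -fE -triple_add1//; congr triple; exact: fE.
have E2 : triple m n Om phi psi a1 a1 a1 = triple m n Om phi psi s a1 a1 +
   (triple m n Om phi psi a0 s a1 + (triple m n Om phi psi a0 a0 s + triple m n Om phi psi a0 a0 a0)).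
  rewrite -triple_add3// -a1E -triple_add2// -a1E -triple_add1//; congr triple; exact: a1E.
have E3 : n W * (m (fun x => a0 x ^+ 3) - 2 * e0) <= triple m n Om phi psi a0 a0 a0.
  rewrite -stZr//; apply: st_le => // g; rewrite -/(W g).
  have [->|Wg] := eqVneq (W g) 0; first by rewrite !mul0r.
  have : 0 < W g by rewrite lt_neqAle eq_sym Wg Om0.
  rewrite {1}/W /Om lt_max ltxx /= => lg.
  rewrite ler_wpM2l ?Om0// -[2 * e0](st_cst m) -stB//; apply: st_le => // x.
  have h1 : `|a0 (x + phi g) - a0 x| <= e0.
    apply: le_trans (a0l _ _) _; rewrite addrAC subrr add0r.
    by have := l0 (psi g); lra.
  have h2 : `|a0 (x + psi g) - a0 x| <= e0.
    apply: le_trans (a0l _ _) _; rewrite addrAC subrr add0r.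
    by have := l0 (phi g); lra.
  set p := a0 (x + phi g) in h1 *; set q := a0 (x + psi g) in h2 *; set r := a0 x in h1 h2 *.
  have r1 : `|r| <= 1 by exact: a01.
  have q1 : `|q| <= 1 by exact: a01.
  have : `|r * q * (p - r) + r ^+ 2 * (q - r)| <= e0 + e0.
    have rq1 : `|r * q| <= 1 by rewrite normrM mulr_ile1.
    have r21 : `|r ^+ 2| <= 1 by rewrite normrX exprn_ile1.
    apply: le_trans (ler_normD _ _) _; rewrite normrM [ `|r ^+ 2 * _|]normrM.
    by apply: lerD; rewrite -[leRHS]mul1r; apply: ler_pM.
  have -> : r * q * (p - r) + r ^+ 2 * (q - r) = r * (p * q) - r ^+ 3 by ring.
  by rewrite ler_norml => /andP[]; lra.
have E4 : m f ^+ 3 - 3 * e0 <= m (fun x => a0 x ^+ 3).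
  apply: le_trans (cube_mean_le a001).
  have : `|m f - m a0| <= e0.
    rewrite -stB//; have := a0o (fun=> 1) (AP_cst _ 1); rewrite normr1.
    by under eq_fun do rewrite mulr1; apply.
  have a00 : 0 <= m a0 by apply: st_ge0 => // x; case/andP: (a001 x).
  have a0le : m a0 <= 1 by rewrite -(st1 m); apply: st_le => // x; case/andP: (a001 x).
  move: (m f) (m a0) d0 d1 a00 a0le => x y x0 x1 y0 y1.
  move=> hxy; have : `|(x - y) * (x ^+ 2 + x * y + y ^+ 2)| <= e0 * 3.
    rewrite normrM ler_pM//.
    have x2 : x ^+ 2 <= 1 by rewrite exprn_ile1.
    have y2 : y ^+ 2 <= 1 by rewrite exprn_ile1.
    have xy : x * y <= 1 by rewrite mulr_ile1.
    have xy0 : 0 <= x * y by rewrite mulr_ge0.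
    have := sqr_ge0 x; have := sqr_ge0 y.
    by rewrite ler_norml; lra.
  have -> : (x - y) * (x ^+ 2 + x * y + y ^+ 2) = x ^+ 3 - y ^+ 3 by ring.
  by rewrite ler_norml => /andP[]; lra.
have bM : bdd M by rewrite /M.
have bSi : bdd (fun g => (`[< S g >])%:R : R) by [].
have d3 : 0 <= m f ^+ 3 by rewrite exprn_ge0.
have up : triple m n Om phi psi f f f <= n W * (m f ^+ 3 - eps).
  (* On [S] the pointwise bound fails by at most [1 + eps], which costs nothing because [S] has
     [n]-mean 0. *)
  rewrite -[leRHS]addr0 -(mulr0 (1 + eps)) -nS -stZr// -stZ// -stD//.
  apply: st_le => // g; rewrite -/(W g) -/(M g); case: asboolP => Sg; last first.
    by rewrite mulr0 addr0 ler_wpM2l ?Om0// hM.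
  rewrite mulr1; have W1 : W g <= 1 by exact: le_trans (ler_norm _) (Om1 _ _).
  have Wge : 0 <= W g by exact: Om0.
  have M1 : M g <= 1.
    apply: le_trans (ler_norm _) _; apply: st_bound => x.
    by rewrite !normrM !mulr_ile1// mulr_ge0.
  have M0 : W g * M g <= W g by rewrite ler_piMr.
  have h1 : 0 <= W g * m f ^+ 3 by rewrite mulr_ge0.
  have h2 : W g * eps <= eps by rewrite ler_piMl// ltW.
  by rewrite mulrBr; lra.
have : n W * (m f ^+ 3 - 3 * e0 - 2 * e0) <= n W * (m (fun x => a0 x ^+ 3) - 2 * e0).
  by rewrite ler_pM2l// lerD2r.
have lo : n W * (m f ^+ 3 - eps) < n W * (m f ^+ 3 - 14 * e0) by rewrite ltr_pM2l//; lra.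
move: t1 t2 t3 s1' s2' s3'; rewrite !ler_norml.
move=> /andP[t1 _] /andP[t2 _] /andP[t3 _] /andP[s1' _] /andP[s2' _] /andP[s3' _].
move: up lo nWs; rewrite E1 E2 -/W => up lo nWs h; move: s1' s2' s3'.
rewrite -/W; lra.
Qed.

End Khintchine.

(** * Upper Banach density *)

Section LimnSup.
Variable R : realType.
Implicit Types (u v : nat -> R) (c : R).

Lemma bounded_fun_unit u : (forall n, 0 <= u n <= 1) -> bounded_fun u.
Proof.
move=> u01; exists 1; split=> // M M1 x _ /=.
by have /andP[h0 h1] := u01 x; rewrite ger0_norm// (le_trans h1)// ltW.
Qed.

Lemma limn_sup_le u v c : (forall n, 0 <= u n <= 1) -> (v @ \oo --> (0 : R)) ->
  (forall n, u n <= c + v n) -> limn_sup u <= c.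
Proof.
move=> u01 v0 uv; have bu := bounded_fun_unit u01.
rewrite limn_supE//; apply/ler_addgt0Pr => e e0.
have [N _ hN] : \forall n \near \oo, v n < e.
  by move/cvgrPdist_lt : v0 => /(_ e e0); apply: filterS => n; rewrite sub0r normrN => /ltr_normlW.
apply: (@le_trans _ _ (sups u N)).
  apply: ge_inf; [exact: bounded_fun_has_lbound_sups|by exists N].
rewrite /sups /=; apply: ge_sup; first by exists (u N); exists N => /=.
move=> _ [k /= Nk <-]; apply: le_trans (uv k) _; rewrite lerD2l ltW//.
exact: hN.
Qed.

Lemma limn_sup_ge u v c : (forall n, 0 <= u n <= 1) -> (v @ \oo --> (0 : R)) ->
  (forall n, c - v n <= u n) -> c <= limn_sup u.
Proof.
move=> u01 v0 uv; have bu := bounded_fun_unit u01.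
rewrite limn_supE//; apply: lb_le_inf; first by exists (sups u 0); exists 0%N.
move=> _ [n _ <-]; apply/ler_addgt0Pr => e e0.
have [N _ hN] : \forall n \near \oo, v n < e.
  by move/cvgrPdist_lt : v0 => /(_ e e0); apply: filterS => k; rewrite sub0r normrN => /ltr_normlW.
apply: (@le_trans _ _ (u (maxn n N) + e)).
  have := uv (maxn n N); have := hN (maxn n N) (leq_maxr _ _); lra.
rewrite lerD2r; apply: ub_le_sup.
  by apply: has_ubound_sdrop; exact: bounded_fun_has_ubound.
by exists (maxn n N) => //=; exact: leq_maxl.
Qed.

End LimnSup.

Section Density.
Variables (R : realType) (G : countZmodType).
Local Open Scope fset_scope.
Local Open Scope ring_scope.
Implicit Types (F : {fset G}) (E S : set G).

Definition ind E (x : G) : R := (`[< E x >])%:R.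

Lemma ind_bdd E : bdd (ind E).
Proof. by rewrite /ind. Qed.

Lemma ind01 E x : 0 <= ind E x <= 1.
Proof. by rewrite /ind; case: asboolP => _; rewrite ?lexx ?ler01. Qed.

Lemma fdensE E F : fdens R E F = (\sum_(x <- F) ind E x) / #|` F|%:R.
Proof.
rewrite /fdens; congr (_ / _).
rewrite card_fset_sum1 big_fset /= big_mkcond natr_sum.
by apply: eq_bigr => x _; rewrite /ind (_ : (x \in E) = `[< E x >])//; case: asboolP.
Qed.

Lemma card_gt0 F : F != fset0 -> 0 < #|` F|%:R :> R.
Proof. by rewrite -cardfs_gt0 ltr0n. Qed.

Lemma sum_ind_le E F : \sum_(x <- F) ind E x <= #|` F|%:R.
Proof.
rewrite card_fset_sum1 natr_sum; apply: ler_sum => x _.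
by case/andP: (ind01 E x).
Qed.

Lemma fdens01 E F : 0 <= fdens R E F <= 1.
Proof.
rewrite fdensE divr_ge0 ?ler0n//=; last first.
  by apply: sumr_ge0 => x _; case/andP: (ind01 E x).
have [->|F0] := eqVneq F fset0; first by rewrite cardfs0 invr0 mulr0 ler01.
by rewrite ler_pdivrMr ?card_gt0// mul1r sum_ind_le.
Qed.

Lemma mem_ftranslate F g x : (x \in ftranslate F g) = (x - g \in F).
Proof.
apply/imfsetP/idP => [[y yF ->]|xF]; first by rewrite addrK.
by exists (x - g); rewrite ?subrK.
Qed.

Lemma card_ftranslate F g : #|` ftranslate F g| = #|` F|.
Proof. by rewrite card_imfset//; exact: addIr. Qed.

Lemma sum_ftranslate F g (f : G -> R) : \sum_(x <- ftranslate F g) f x = \sum_(x <- F) f (x + g).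
Proof. by rewrite /ftranslate big_imfset//= => x y _ _; exact: addIr. Qed.

Lemma sum_symdiff E (A B : {fset G}) :
  \sum_(x <- B) ind E x <= \sum_(x <- A) ind E x + #|` fsymdiff A B|%:R.
Proof.
rewrite (big_fsetID _ (mem A) B) /=; apply: lerD.
  rewrite [leRHS](big_fsetID _ (mem B) A) /=.
  rewrite (_ : [fset x in B | x \in A] = [fset x in A | x \in B]); last first.
    by apply/fsetP => x; rewrite !inE andbC.
  by rewrite lerDl; apply: sumr_ge0 => x _; case/andP: (ind01 E x).
apply: le_trans (sum_ind_le _ _) _; rewrite ler_nat; apply: fsubset_leq_card.
apply/fsubsetP => x; rewrite !inE => /andP[xB xA].
by rewrite xB xA orbT.
Qed.

(** The density of [E] in [F N] exceeds its average over the translates by [s] by at most [v N],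
    which tends to 0 by the Folner property. *)
Lemma upper_banach_density_le E : upper_banach_density R E <= upper_mean (ind E).
Proof.
rewrite /upper_banach_density; set A := [set _ | _].
(* Without Folner sequences the density is [sup set0 = 0]. *)
have [->|/set0P A0] := eqVneq A set0.
  rewrite sup0; apply: upper_mean_ge (ind_bdd E) _ => c [s s0 /(_ 0) hs].
  rewrite -(ler_pM2r (size_gt0r R s0)) mul0r; apply: le_trans hs.
  by apply: sumr_ge0 => x _; case/andP: (ind01 E (0 + x)).
apply: ge_sup => // _ [F [[Fn0 hF] ->]].
apply: upper_mean_ge (ind_bdd E) _ => c [s s0 hs].
have ss := size_gt0r R s0.
pose v N : R := (size s)%:R^-1 * \sum_(a <- s)
   (#|` fsymdiff (ftranslate (F N) a) (F N)|%:R / #|` F N|%:R).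
apply: (@limn_sup_le _ _ v); first by move=> N; exact: fdens01.
- suff : v @ \oo --> (size s)%:R^-1 * \sum_(a <- s) (0 : R) by rewrite big1// mulr0.
  apply: cvgM; first exact: cvg_cst.
  by apply: cvg_big => [|a _]; [exact: add_continuous|exact: hF].
- move=> N; have FN := card_gt0 (Fn0 N).
  rewrite -(ler_pM2l ss) /v /= mulrDr mulVKf ?gt_eqF// fdensE.
  rewrite -(ler_pM2r FN) -[leLHS]mulrA divfK ?gt_eqF// mulrDl [X in _ <= _ + X]mulr_suml.
  rewrite (_ : (size s)%:R * _ = \sum_(a <- s) \sum_(x <- F N) ind E x); last first.
    by rewrite big_const_seq iter_addr addr0 count_predT -[RHS]mulr_natl.
  apply: (@le_trans _ _ (\sum_(a <- s) (\sum_(x <- ftranslate (F N) a) ind E x +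
      #|` fsymdiff (ftranslate (F N) a) (F N)|%:R))).
    by apply: ler_sum => a _; exact: sum_symdiff.
  rewrite big_split /=; apply: lerD; last first.
    by apply: ler_sum => a _; rewrite divfK// gt_eqF.
  under eq_bigr do rewrite sum_ftranslate.
  rewrite exchange_big /=; apply: (@le_trans _ _ (\sum_(x <- F N) (c * (size s)%:R))).
    by apply: ler_sum => x _; exact: hs.
  by rewrite big_const_seq iter_addr addr0 count_predT -[leLHS]mulr_natr [c * _]mulrC.
Qed.

Lemma ftranslate_symdiff F g x :
  fsymdiff (ftranslate (ftranslate F x) g) (ftranslate F x) = ftranslate (fsymdiff (ftranslate F g) F) x.
Proof.
apply/fsetP => y; rewrite /fsymdiff mem_ftranslate !inE !mem_ftranslate.
by rewrite addrAC.
Qed.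

Lemma Folner_translate (F : nat -> {fset G}) (x : nat -> G) :
  Folner R F -> Folner R (fun N => ftranslate (F N) (x N)).
Proof.
move=> [Fn0 hF]; split=> [N|g].
  by rewrite -cardfs_gt0 card_ftranslate cardfs_gt0.
by under eq_fun do rewrite ftranslate_symdiff !card_ftranslate; exact: hF.
Qed.

(** Some translate of [F N] has density at least [u - 1 / N.+1], for otherwise [F N], as a list,
    would witness a smaller upper mean. Translates of a Folner sequence are again Folner. *)
Lemma upper_mean_le_density (F : nat -> {fset G}) S : Folner R F ->
  upper_mean (ind S) <= upper_banach_density R S.
Proof.
move=> hF; set u := upper_mean _.
have /choice[x hx] : forall N, exists x, u - N.+1%:R^-1 <= fdens R S (ftranslate (F N) x).
  move=> N; apply: contrapT => hno.
  have FN := card_gt0 (hF.1 N).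
  have : u <= u - N.+1%:R^-1.
    apply: upper_mean_le (ind_bdd S) _; exists (F N).
      by rewrite -size_eq0 -lt0n -(ltr0n R).
    move=> x; rewrite leNgt; apply/negP => h; apply: hno; exists x.
    rewrite fdensE card_ftranslate sum_ftranslate ler_pdivlMr// ltW//.
    by under eq_bigr do rewrite addrC.
  by apply/negP; rewrite -ltNge gtrBl invr_gt0 ltr0n.
have hF' := Folner_translate x hF.
apply: (@le_trans _ _ (limn_sup (fun N => fdens R S (ftranslate (F N) (x N))))).
  apply: (@limn_sup_ge _ _ (fun N => N.+1%:R^-1)) => // [N|].
    exact: fdens01.
  exact: cvg_harmonic.
apply: ub_le_sup; last by exists (fun N => ftranslate (F N) (x N)).
exists 1 => _ [F' [_ ->]]; apply: (@limn_sup_le _ _ (fun=> 0)) => [N||N].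
- exact: fdens01.
- exact: cvg_cst.
- by rewrite addr0; case/andP: (fdens01 S (F' N)).
Qed.

Lemma density_gt0_Folner E : 0 < upper_banach_density R E -> exists F : nat -> {fset G}, Folner R F.
Proof.
move=> d0; apply: contrapT => hno; move: d0; rewrite /upper_banach_density.
rewrite (_ : [set l | _] = set0) ?sup0 ?ltxx//.
by apply/seteqP; split=> // l [F [hF _]]; apply: hno; exists F.
Qed.

(** Every finite list has a translate avoiding [S], where the average of the indicator of the
    complement is 1. *)
Lemma not_syndetic_upper_mean S : ~ syndetic S -> 1 <= upper_mean (ind (~` S)).
Proof.
move=> nS; apply: upper_mean_ge (ind_bdd _) _ => c [s s0 hs].
have [g hg] : exists g, forall a, a \in s -> ~ S (g + a).
  apply: contrapT => hno; apply: nS; exists [fset - a | a in s] => g.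
  apply: contrapT => hg; apply: hno; exists g => a sa Sga; apply: hg.
  exists (- a); last by rewrite opprK.
  by apply/imfsetP; exists a.
rewrite -(ler_pM2r (size_gt0r R s0)) mul1r; apply: le_trans (hs g).
rewrite -sum1_size natr_sum big_seq [leRHS]big_seq; apply: ler_sum => a sa.
by rewrite /ind asboolT//; exact: hg.
Qed.

End Density.

Theorem theorem1p14 (R : realType) (G : countZmodType)
    (phi psi : {additive G -> G}) :
  finite_index (range phi) ->
  finite_index (range psi) ->
  finite_index (range (fun x => phi x - psi x)) ->
  forall (E : set G) (eps : R),
    0 < upper_banach_density R E -> 0 < eps ->
    syndetic [set g : G |
      upper_banach_density R (E `&` set_shift E (phi g) `&` set_shift E (psi g))
        > upper_banach_density R E ^+ 3 - eps].
Proof.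
move=> [K1 hK1] [K2 hK2] [K3 hK3] E eps d0 eps0.
have [F hF] := density_gt0_Folner d0.
set S := [set g | _]; apply: contrapT => nS.
have [m [im exm mE]] := exists_extremal (ind_bdd R E).
have em := extremal_ergodic im exm.
have [n [inn _ nE]] := exists_extremal (ind_bdd R (~` S)).
have n0 : n (fun g => (`[< S g >])%:R) = 0.
  apply/eqP; rewrite eq_le; apply/andP; split; last first.
    by apply: st_ge0.
  have -> : (fun g => (`[< S g >])%:R) = (fun g => 1 - ind R (~` S) g).
    apply: funext => g; rewrite /ind; case: asboolP => h.
      by rewrite asboolF ?subr0//; apply.
    by rewrite asboolT// subrr.
  have bS := ind_bdd R (~` S).
  by rewrite stB// st_cst nE subr_le0; exact: not_syndetic_upper_mean.
have hphi : hom phi by move=> x y; rewrite raddfD.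
have hpsi : hom psi by move=> x y; rewrite raddfD.
have [g nSg hg] := khintchine_mean im em hphi hpsi hK1 hK2 hK3 (@ind01 R _ E) inn eps0 n0.
apply: nSg; rewrite /S /=.
have dE : upper_banach_density R E <= m (ind R E) by rewrite mE upper_banach_density_le.
have d3 : upper_banach_density R E ^+ 3 <= m (ind R E) ^+ 3.
  by rewrite lerXn2r// nnegrE ?(ltW d0)// (le_trans (ltW d0)).
apply: (@lt_le_trans _ _ (m (fun x => ind R E x * (ind R E (x + phi g) * ind R E (x + psi g))))).
  by apply: le_lt_trans hg; rewrite lerD2r.
(* [m] was chosen maximal at [E] only; at the intersection it is some invariant mean, hence a lower
   bound for the density. *)
apply: le_trans (upper_mean_le_density _ hF).
apply: le_trans (inv_le_upper_mean im (ind_bdd R _)).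
rewrite le_eqVlt; apply/orP; left; apply/eqP; congr (m _); apply: funext => x.
have shiftE h : set_shift E h x <-> E (x + h).
  split=> [[e Ee <-]|Exh]; first by rewrite subrK.
  by exists (x + h) => //; rewrite addrK.
have indM (A B : set G) : ind R (A `&` B) x = ind R A x * ind R B x.
  rewrite /ind; case: (asboolP (A x)) => hA; last by rewrite mul0r asboolF// => -[].
  by rewrite mul1r; congr (_%:R); congr nat_of_bool; apply: asbool_equiv_eq; split=> [[]|].
have indS h : ind R (set_shift E h) x = ind R E (x + h).
  by rewrite /ind; congr (_%:R); congr nat_of_bool; exact: asbool_equiv_eq.
by rewrite !indM !indS mulrA.
Qed.
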